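(* Let $\Omega\subset\mathbb R^n$ be a bounded convex domain and suppose that, for some $x_0\in\partial\Omega$ and $R>0$, $\partial\Omega\cap B_R(x_0)$ consists of $k$ $C^{1,1}$-hypersurfaces $S_1,\dots,S_k$, with the angle between any two of the tangent planes at $x_0$ less than $\pi$. Let $f\in C(\bar\Omega)\cap C^\infty(\Omega)$ be the solution of $$\Delta f-\frac{f_if_j}{1+|\nabla f|^2}f_{ij}+\frac nf=0\ \text{ in }\Omega,\qquad f>0\ \text{ in }\Omega,\qquad f=0\ \text{ on }\partial\Omega,$$ and let $f_V$ be the corresponding solution in the tangent cone $V$ of $\Omega$ at $x_0$, i.e. the solution of the same Dirichlet problem with $\Omega$ replaced by $V$. Then for every $\delta>0$ there exist $r>0$ and a constant $C$, where $C$ depends only on $\delta$ and the geometry of $\partial\Omega$ near $x_0$, such that for every $x\in\Omega$ with $|x-x_0|<r$ and $\operatorname{dist}(x,\partial\Omega)\ge\delta|x-x_0|$, $$|f(x)-f_V(x)|\le C f(x)\,|x-x_0|.$$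
   Context: Subscripts denote partial derivatives ($f_i=\partial_i f$, $f_{ij}=\partial_{ij}f$) and repeated indices are summed from $1$ to $n$. $B_R(x_0)$ is the open ball of radius $R$ centered at $x_0$. The hypersurfaces $S_i$ all pass through $x_0$. The tangent cone $V$ of $\Omega$ at $x_0$ is the infinite open convex cone with vertex $x_0$ bounded by the tangent hyperplanes $P_i$ of $S_i$ at $x_0$, $i=1,\dots,k$: with $\nu_i$ the unit normal of $P_i$ pointing to the side of $\Omega$, $V=\{x:\langle x-x_0,\nu_i\rangle>0,\ i=1,\dots,k\}$. The angle between two tangent planes is the (interior) dihedral angle measured on the side containing $\Omega$. The solution $f_V$ in the infinite cone $V$ is the function in $C(\bar V)\cap C^\infty(V)$ satisfying the same equation in $V$, positive in $V$ and zero on $\partial V$; for such a cone (contained in a wedge bounded by two hyperplanes meeting at angle less than $\pi$) this solution exists, is unique, and has the form $f_V(x)=|x-x_0|\,g_V(\theta)$ with $\theta=(x-x_0)/|x-x_0|\in\mathbb S^{n-1}$. *)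

(* Defs.v *)
From HB Require Import structures.
From mathcomp Require Import all_boot all_order all_algebra.
From mathcomp Require Import all_classical all_reals all_analysis.

Set Implicit Arguments.
Unset Strict Implicit.
Unset Printing Implicit Defensive.

Import Order.TTheory GRing.Theory Num.Theory.
Import numFieldTopology.Exports numFieldNormedType.Exports.

Local Open Scope classical_set_scope.
Local Open Scope ring_scope.

(* The library norm on 'rV[R]_n is the sup norm, so the Euclidean norm is
   defined here; the two induce the same topology, bounded sets, derivatives
   and Lipschitz functions, for which the library notions are used. *)
Definition dot (R : realType) (n : nat) (x y : 'rV[R]_n) : R :=
  \sum_(i < n) x 0 i * y 0 i.

Definition enorm (R : realType) (n : nat) (x : 'rV[R]_n) : R :=
  Num.sqrt (dot x x).

Definition eball (R : realType) (n : nat) (x0 : 'rV[R]_n) (r : R) :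
    set 'rV[R]_n :=
  [set x | enorm (x - x0) < r].

Definition dist_set (R : realType) (n : nat) (x : 'rV[R]_n) (A : set 'rV[R]_n) : R :=
  inf [set enorm (x - y) | y in A].

Definition boundary (T : topologicalType) (A : set T) : set T :=
  closure A `\` interior A.

Definition bounded_convex_domain (R : realType) (n : nat)
    (Omega : set 'rV[R]_n) : Prop :=
  [/\ open Omega, Omega !=set0, @convex_set R 'rV[R]_n Omega
    & bounded_set Omega].

Definition partial (R : realType) (n : nat) (i : 'I_n) (f : 'rV[R]_n -> R)
    (x : 'rV[R]_n) : R :=
  'D_(delta_mx 0 i) f x.

Definition grad (R : realType) (n : nat) (f : 'rV[R]_n -> R) (x : 'rV[R]_n) :
    'rV[R]_n :=
  \row_(i < n) partial i f x.

(* C^oo on an open set D: every iterated partial derivative is (Frechet)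
   differentiable, hence continuous, at every point of D. *)
Definition smooth_on (R : realType) (n : nat) (D : set 'rV[R]_n)
    (f : 'rV[R]_n -> R) : Prop :=
  forall (s : seq 'I_n) (x : 'rV[R]_n), D x ->
    differentiable (foldr (@partial R n) f s) x.

Definition C11_on (R : realType) (n : nat) (U : set 'rV[R]_n)
    (rho : 'rV[R]_n -> R) : Prop :=
  (forall x, U x -> differentiable rho x) /\
  [lipschitz (grad rho x) | x in U].

(* Near p, S is an (n-1)-dimensional piece of the regular C^{1,1} level set
   [rho = 0]. S may have an edge, and p may lie on it: in U the interior of S
   relative to [rho = 0] is only required to be dense in S. *)
Definition C11_chart (R : realType) (n : nat) (S : set 'rV[R]_n)
    (p : 'rV[R]_n) (U : set 'rV[R]_n) (rho : 'rV[R]_n -> R) : Prop :=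
  [/\ open U /\ U p,
      C11_on U rho,
      (forall x, U x -> grad rho x != 0),
      (forall x, U x -> S x -> rho x = 0)
    & U `&` S `<=`
        closure [set q | [/\ U q, rho q = 0
                           & \forall y \near q, rho y = 0 -> S y]]].

Definition C11_hypersurface (R : realType) (n : nat) (S : set 'rV[R]_n) : Prop :=
  forall p, S p -> exists U rho, C11_chart S p U rho.

(* nu is one of the two unit normals of the tangent hyperplane of S at p. *)
Definition unit_normal (R : realType) (n : nat) (S : set 'rV[R]_n)
    (p nu : 'rV[R]_n) : Prop :=
  enorm nu = 1 /\
  exists U rho (c : R), C11_chart S p U rho /\ nu = c *: grad rho p.

(* Angle of the wedge {<x, nu1> > 0, <x, nu2> > 0} with inner unit normals
   nu1, nu2: it is supplementary to the angle between nu1 and nu2. *)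
Definition dihedral_angle (R : realType) (n : nat) (nu1 nu2 : 'rV[R]_n) : R :=
  pi - acos (dot nu1 nu2).

Definition open_cone (R : realType) (n k : nat) (x0 : 'rV[R]_n)
    (nu : 'I_k -> 'rV[R]_n) : set 'rV[R]_n :=
  [set x | forall i, 0 < dot (x - x0) (nu i)].

Definition minimal_graph_op (R : realType) (n : nat) (f : 'rV[R]_n -> R)
    (x : 'rV[R]_n) : R :=
  \sum_(i < n) partial i (partial i f) x
  - \sum_(i < n) \sum_(j < n)
      partial i f x * partial j f x / (1 + enorm (grad f x) ^+ 2)
        * partial i (partial j f) x
  + n%:R / f x.

Definition dirichlet_solution (R : realType) (n : nat) (D : set 'rV[R]_n)
    (f : 'rV[R]_n -> R) : Prop :=
  [/\ {within closure D, continuous f},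
      smooth_on D f,
      (forall x, D x -> minimal_graph_op f x = 0),
      (forall x, D x -> 0 < f x)
    & (forall x, boundary D x -> f x = 0)].

(* "f is the solution in D"; only values on the closure of D are meaningful. *)
Definition the_dirichlet_solution (R : realType) (n : nat) (D : set 'rV[R]_n)
    (f : 'rV[R]_n -> R) : Prop :=
  dirichlet_solution D f /\
  forall g, dirichlet_solution D g -> forall x, closure D x -> g x = f x.

(* Main.v *)
Require Import Defs.
From HB Require Import structures.
From mathcomp Require Import all_boot all_order all_algebra.
From mathcomp Require Import all_classical all_reals all_analysis.
From mathcomp Require Import ring lra.

Set Implicit Arguments.
Unset Strict Implicit.
Unset Printing Implicit Defensive.

Import Order.TTheory GRing.Theory Num.Theory.
Import numFieldTopology.Exports numFieldNormedType.Exports.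

Local Open Scope classical_set_scope.
Local Open Scope ring_scope.

(** In the half-space model of hyperbolic space the equation says that the graph
of f is a minimal hypersurface, so it is preserved by translations along the
boundary, by dilations and by inversions centred at boundary points. Moreover
n / f is strictly decreasing in f, so that two solutions, one of which is
lifted by a positive constant, can never touch from the wrong side: comparing
second derivatives at the point of contact is already contradictory.

Upper bound. Omega lies in V, so f <= fV by [comparison].

Lower bound. Uniqueness of fV and dilation invariance make fV homogeneous of
degree one about x0 ([homogeneous]); hence its graph is invariant under the
inversion at x0. Translate this graph by a vector b which points steeply into
V, and invert at x0. The result is the minimal hypersurface
  q = fV (x - (|x - x0|^2 + q^2) b),
whose projection lies in {<x - x0, nu_i> > <b, nu_i> |x - x0|^2 for all i}, an intersection of balls tangent to the faces of V at x0. As the S_i are of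
class C^{1,1}, they stay within L |x - x0|^2 of their tangent planes
([C11_tangent]), so for steep b this region is contained in Omega
([cusp_inside]). The lift-and-touch argument then places the hypersurface below
the graph of f ([mobius_barrier]).

It remains to see how far the hypersurface is from the graph of fV. At a point
x with dist(x, boundary Omega) >= delta |x - x0| the direction of x - x0 stays
in a compact part of the open cone ([dist_boundary_le]), where fV is bounded
below and has bounded gradient after rescaling to |x - x0| = 1. The shift by
(|x - x0|^2 + q^2) b is of relative size O(|x - x0|), so it changes fV by a
factor 1 + O(|x - x0|) only ([cone_estimate]). The vector b depends on the S_i
and the other constants on V, delta and b; this is why C can be chosen before
Omega and f. *)

(** * Euclidean algebra and the contracted Hessian inequality *)

Section Dot.
Context {R : realType} {n : nat}.
Implicit Types (x y z u v : 'rV[R]_n) (a : R).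

Lemma dotC x y : dot x y = dot y x.
Proof. by apply: eq_bigr => i _; rewrite mulrC. Qed.

Lemma dotDl x y z : dot (x + y) z = dot x z + dot y z.
Proof.
by rewrite /dot -big_split /=; apply: eq_bigr => i _; rewrite mxE mulrDl.
Qed.

Lemma dotZl a x y : dot (a *: x) y = a * dot x y.
Proof. by rewrite /dot mulr_sumr; apply: eq_bigr => i _; rewrite mxE mulrA. Qed.

Lemma dotNl x y : dot (- x) y = - dot x y.
Proof. by rewrite -scaleN1r dotZl mulN1r. Qed.

Lemma dotBl x y z : dot (x - y) z = dot x z - dot y z.
Proof. by rewrite dotDl dotNl. Qed.

Lemma dotDr x y z : dot z (x + y) = dot z x + dot z y.
Proof. by rewrite !(dotC z) dotDl. Qed.

Lemma dotZr a x y : dot x (a *: y) = a * dot x y.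
Proof. by rewrite !(dotC x) dotZl. Qed.

Lemma dotNr x y : dot x (- y) = - dot x y.
Proof. by rewrite !(dotC x) dotNl. Qed.

Lemma dotBr x y z : dot z (x - y) = dot z x - dot z y.
Proof. by rewrite !(dotC z) dotBl. Qed.

Lemma dot0l x : dot 0 x = 0.
Proof. by rewrite -(scale0r 0) dotZl mul0r. Qed.

Lemma dot0r x : dot x 0 = 0.
Proof. by rewrite dotC dot0l. Qed.

Definition dotE := (dotDl, dotDr, dotBl, dotBr, dotNl, dotNr, dotZl, dotZr).

Lemma dot_delta x (i : 'I_n) : dot x (delta_mx 0 i) = x 0 i.
Proof.
rewrite /dot (bigD1 i) //= mxE !eqxx mulr1 big1 ?addr0 // => j ji.
by rewrite mxE (negbTE ji) andbF mulr0.
Qed.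

Lemma dot_ge0 x : 0 <= dot x x.
Proof. by apply: sumr_ge0 => i _; rewrite -expr2 sqr_ge0. Qed.

Lemma dot_eq0 x : (dot x x == 0) = (x == 0).
Proof.
apply/eqP/eqP => [x0|->]; last exact: dot0l.
apply/rowP => i; rewrite mxE; apply/eqP; rewrite -sqrf_eq0 expr2.
move/eqP: x0; rewrite psumr_eq0; last by move=> j _; rewrite -expr2 sqr_ge0.
by move=> /allP/(_ i); rewrite mem_index_enum => /(_ isT).
Qed.

Lemma enorm_ge0 x : 0 <= enorm x.
Proof. exact: sqrtr_ge0. Qed.

Lemma enorm_sqr x : enorm x ^+ 2 = dot x x.
Proof. by rewrite sqr_sqrtr ?dot_ge0. Qed.

Lemma enormZ a x : enorm (a *: x) = `|a| * enorm x.
Proof.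
by rewrite /enorm dotZl dotZr mulrA -expr2 sqrtrM ?sqr_ge0 // sqrtr_sqr.
Qed.

Lemma enorm_eq0 x : (enorm x == 0) = (x == 0).
Proof. by rewrite -dot_eq0 -enorm_sqr sqrf_eq0. Qed.

Lemma enorm_gt0 x : (0 < enorm x) = (x != 0).
Proof. by rewrite lt_def enorm_ge0 andbT enorm_eq0. Qed.

Lemma dot_unit_le x u : enorm u = 1 -> dot x u <= enorm x.
Proof.
move=> u1; have uu : dot u u = 1 by rewrite -enorm_sqr u1 expr1n.
apply: le_trans (ler_norm _) _; rewrite -sqrtr_sqr ler_wsqrtr //.
by have := dot_ge0 (x - dot x u *: u); rewrite !dotE uu (dotC u x); lra.
Qed.

Definition bil (Q : 'M[R]_n) u v : R := dot (u *m Q) v.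

Lemma bilDl Q x y z : bil Q (x + y) z = bil Q x z + bil Q y z.
Proof. by rewrite /bil mulmxDl dotDl. Qed.
Lemma bilDr Q x y z : bil Q z (x + y) = bil Q z x + bil Q z y.
Proof. exact: dotDr. Qed.
Lemma bilZl Q a x y : bil Q (a *: x) y = a * bil Q x y.
Proof. by rewrite /bil -scalemxAl dotZl. Qed.
Lemma bilZr Q a x y : bil Q x (a *: y) = a * bil Q x y.
Proof. exact: dotZr. Qed.
Lemma bilNl Q x y : bil Q (- x) y = - bil Q x y.
Proof. by rewrite -scaleN1r bilZl mulN1r. Qed.
Lemma bilNr Q x y : bil Q x (- y) = - bil Q x y.
Proof. exact: dotNr. Qed.

Definition bilE := (bilDl, bilDr, bilNl, bilNr, bilZl, bilZr).

Lemma bil_sum Q u v : bil Q u v = \sum_i \sum_j u 0 i * v 0 j * Q i j.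
Proof.
rewrite exchange_big /=; apply: eq_bigr => j _.
by rewrite mxE mulr_suml; apply: eq_bigr => i _; rewrite mulrAC.
Qed.

Lemma dot_mx u v : dot u v = (u *m v^T) 0 0.
Proof. by rewrite mxE; apply: eq_bigr => i _; rewrite mxE. Qed.

Lemma mxtrace_rank1 (u v : 'rV[R]_n) Q : \tr (u^T *m (v *m Q)) = bil Q v u.
Proof.
by rewrite mxtrace_mulC /bil dot_mx trace_mx11.
Qed.

(** The matrix 1 - P^T P / (1 + |P|^2) of leading coefficients is the sum over
m of w_m^T w_m with w_m = e_m - k P_m P, because k solves
2 k - k^2 |P|^2 = 1 / (1 + |P|^2). Hence contracting H with it amounts to
summing bil H (w_m) (w_m). *)
Lemma trace_le0 (H : 'M[R]_n) (P : 'rV[R]_n) :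
  (forall v, bil H v v <= 0) ->
  \tr H - bil H P P / (1 + dot P P) <= 0.
Proof.
move=> H0; set p := dot P P; have p0 : 0 <= p := dot_ge0 P.
(* With s^2 = 1 + |P|^2 the root of 2 k - k^2 |P|^2 = 1 / s^2 needed below is
   k = 1 / (s (s + 1)). *)
pose s := Num.sqrt (1 + p); have s2 : s ^+ 2 = 1 + p.
  by rewrite sqr_sqrtr // addr_ge0.
have s0 : 0 < s by rewrite sqrtr_gt0; lra.
pose k := (s * (s + 1))^-1.
pose w (m : 'I_n) : 'rV[R]_n := delta_mx 0 m - (k * P 0 m) *: P.
suff <- : \sum_m bil H (w m) (w m) = \tr H - bil H P P / (1 + p).
  by apply: sumr_le0 => m _.
have e1 : \sum_m P 0 m * bil H (delta_mx 0 m) P = bil H P P.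
  rewrite [RHS]bil_sum; apply: eq_bigr => m _.
  rewrite /bil /dot mulr_sumr; apply: eq_bigr => j _.
  by rewrite -rowE mxE; ring.
have e2 : \sum_m P 0 m * bil H P (delta_mx 0 m) = bil H P P.
  by rewrite [RHS]/bil /dot; apply: eq_bigr => m _; rewrite /bil dot_delta mulrC.
have e3 : \sum_m bil H (delta_mx 0 m) (delta_mx 0 m) = \tr H.
  by apply: eq_bigr => m _; rewrite /bil dot_delta -rowE mxE.
have kE : 2 * k - k ^+ 2 * p = (1 + p)^-1.
  have -> : p = s ^+ 2 - 1 by rewrite s2; ring.
  have -> : 1 + (s ^+ 2 - 1) = s ^+ 2 by ring.
  by rewrite /k; field; rewrite !gt_eqF // addr_gt0.
have -> : \tr H - bil H P P / (1 + p) =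
   \tr H - k * bil H P P - k * bil H P P + k ^+ 2 * bil H P P * p.
  by rewrite -kE; ring.
rewrite -{1}e1 -{1}e2 -e3.
have -> : p = \sum_m P 0 m * P 0 m by [].
have [B BE] : exists B, B = bil H P P by exists (bil H P P).
rewrite -BE !mulr_sumr -!sumrB -big_split /=.
apply: eq_bigr => m _; rewrite /w !bilE -BE; ring.
Qed.

(** The pointwise algebra behind the barrier. Here (x, t) is a point of contact
relative to the vertex, P and H are the gradient and Hessian of f there, G and
Q those of the cone solution g at A, and the last hypothesis says that
  psi(y) = g (y - (|y|^2 + ft(y)^2) b) - ft(y),   ft = f + c,
has a nonpositive Hessian. Contract it with 1 - P^T P / (1 + |P|^2). Because A
is in the kernel of Q, the terms in Q recombine into those of the operator of
g at A: this is the conformal invariance of the equation, and rests on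
1 + |G|^2 = mu^2 (1 + |P|^2) with mu = 1 + 2 t <G, b>. The contraction equals
mu n (1 / (t - c) - 1 / t), which is positive. *)
Lemma touching_contradiction (Q H : 'M[R]_n) (x b P G : 'rV[R]_n) (t c : R) :
  let rho := dot x x + t ^+ 2 in
  let drho := 2 *: x + (2 * t) *: P in
  let A := x - rho *: b in
  (0 < n)%N -> 0 < c -> c < t -> 0 <= 1 + 2 * t * dot G b ->
  G = P + dot G b *: drho ->
  dot G A = t ->
  (forall u, bil Q A u = 0) -> (forall u, bil Q u A = 0) ->
  \tr Q - bil Q G G / (1 + dot G G) + n%:R / t = 0 ->
  \tr H - bil H P P / (1 + dot P P) + n%:R / (t - c) = 0 ->
  (forall v, let w := v - dot drho v *: b in
     bil Q w w
     - dot G b * (2 * dot v v + 2 * dot P v ^+ 2 + 2 * t * bil H v v)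
     - bil H v v <= 0) ->
  False.
Proof.
move=> rho drho A n0 c0 ct; set gam := dot G b; pose mu := 1 + 2 * t * gam.
rewrite -/mu => mu0 GE Eul QA AQ eqQ eqH sec.
have t0 : 0 < t by lra.
set p := dot P P in eqH *; have p0 : 0 <= p := dot_ge0 P.
pose X := dot x x; pose xi := dot x P.
have QxE u : bil Q x u = rho * bil Q b u.
  by have := QA u; rewrite /A !bilE; lra.
have xQE u : bil Q u x = rho * bil Q u b.
  by have := AQ u; rewrite /A !bilE; lra.
have GE' : G = mu *: P + (2 * gam) *: x.
  by rewrite {1}GE /drho /mu; apply/rowP => i; rewrite !mxE; ring.
have rhoE : rho = X + t ^+ 2 by [].
(* The Euler identity for g at A, rewritten at the point (x, t). *)
have key : gam * rho = mu * (t - xi).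
  have : dot G x - rho * gam = t by rewrite -Eul /A dotBr dotZr.
  rewrite GE' !dotE -/X (dotC P x) -/xi; rewrite rhoE /mu; lra.
have GG : 1 + dot G G = mu ^+ 2 * (1 + p).
  rewrite GE' !dotE -/X (dotC P x) -/xi -/p.
  have -> : X = rho - t ^+ 2 by rewrite rhoE; ring.
  transitivity (1 + mu ^+ 2 * p + 4 * mu * gam * xi + 4 * gam * (gam * rho)
     - 4 * gam ^+ 2 * t ^+ 2); first by ring.
  by rewrite key /mu; ring.
have mup : 0 < mu.
  rewrite lt_def mu0 andbT; apply/eqP => mu00.
  by move: GG; have := dot_ge0 G; rewrite mu00; lra.
(* v *m J is the derivative of y |-> y - (|y|^2 + ft(y)^2) b at the contact
   point, in the direction v. *)
pose J : 'M[R]_n := 1%:M - drho^T *m b.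
have JE v : v *m J = v - dot drho v *: b.
  rewrite /J mulmxBr mulmx1 mulmxA; congr (_ - _); apply/rowP => i.
  by rewrite !mxE big_ord1 -dot_mx dotC.
pose M := J *m Q *m J^T - gam *: (2 *: 1%:M + 2 *: (P^T *m P) + (2 * t) *: H) - H.
have bilM v : bil M v v = bil Q (v *m J) (v *m J)
     - gam * (2 * dot v v + 2 * dot P v ^+ 2 + 2 * t * bil H v v) - bil H v v.
  have bJ : bil (J *m Q *m J^T) v v = bil Q (v *m J) (v *m J).
    by rewrite /bil !dot_mx !mulmxA trmx_mul !mulmxA.
  have bP : bil (P^T *m P) v v = dot P v ^+ 2.
    rewrite /bil mulmxA; have -> : v *m P^T = (dot P v)%:M.
      by rewrite [LHS]mx11_scalar -dot_mx dotC.
    by rewrite mul_scalar_mx dotZl expr2.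
  rewrite -bJ -bP /bil /M !mulmxBr -!scalemxAr !mulmxDr -!scalemxAr mulmx1.
  by rewrite !dotE.
have /(@trace_le0 _ P) : forall v, bil M v v <= 0.
  by move=> v; rewrite bilM JE; exact: sec.
have trJ : \tr (J *m Q *m J^T) = \tr Q - bil Q b drho - bil Q drho b
     + dot drho drho * bil Q b b.
  have -> : J *m Q *m J^T = Q - drho^T *m (b *m Q) - (Q *m b^T) *m drho
      + drho^T *m (bil Q b b *: drho).
    have -> : bil Q b b *: drho = (b *m Q *m b^T) *m drho.
      by rewrite [X in X *m _]mx11_scalar -dot_mx mul_scalar_mx.
    rewrite /J [(_ - _)^T]linearB /= trmx1 trmx_mul trmxK.
    rewrite mulmxBr mulmx1 mulmxBl mul1mx mulmxBl -!mulmxA opprD opprK.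
    by rewrite !addrA.
  rewrite linearD /= !linearB /= !mxtrace_rank1.
  congr (_ - _ - _ + _).
    by rewrite mxtrace_mulC mulmxA /bil dot_mx trace_mx11.
  rewrite mxtrace_mulC -scalemxAl linearZ /= trace_mx11 -dot_mx.
  by rewrite mulrC.
have trM : \tr M = \tr (J *m Q *m J^T)
    - gam * (2 * n%:R + 2 * p + 2 * t * \tr H) - \tr H.
  rewrite /M !linearB /= linearZ /= !linearD /= !linearZ /= mxtrace1.
  have -> : \tr (P^T *m P) = p by rewrite mxtrace_mulC trace_mx11 -dot_mx.
  by [].
rewrite bilM JE trM trJ.
pose q := bil Q b b; pose q1 := bil Q b P; pose q2 := bil Q P b.
pose T := \tr Q; pose QP := bil Q P P.
rewrite /drho !(bilE, dotE) !xQE !QxE -/q -/q1 -/q2 -/T -/QP.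
rewrite !(dotC P x) -/xi -/X -/p.
have QGG : bil Q G G = mu ^+ 2 * (QP + 2 * (t - xi) * (q1 + q2)
    + 4 * (t - xi) ^+ 2 * q).
  rewrite GE' !bilE !xQE !QxE -/q -/q1 -/q2 -/QP.
  transitivity (mu ^+ 2 * QP + 2 * mu * (gam * rho) * (q1 + q2)
    + 4 * (gam * rho) ^+ 2 * q); first by ring.
  by rewrite key; ring.
rewrite QGG GG in eqQ.
have TE : T = (QP + 2 * (t - xi) * (q1 + q2)
    + 4 * (t - xi) ^+ 2 * q) / (1 + p) - n%:R / t.
  rewrite -mulf_div divff ?mul1r in eqQ; first by rewrite /T; lra.
  by rewrite expf_neq0 ?gt_eqF.
have HE : \tr H = bil H P P / (1 + p) - n%:R / (t - c) by lra.
rewrite TE HE (_ : X = rho - t ^+ 2); last by rewrite rhoE; ring.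
set L := (X in X <= 0); suff -> : L = mu * n%:R * ((t - c)^-1 - t^-1).
  apply/negP; rewrite -ltNge; apply: mulr_gt0.
    by apply: mulr_gt0 => //; rewrite ltr0n.
  by rewrite subr_gt0 ltf_pV2 ?posrE; lra.
rewrite /L /mu. field.
apply/and3P; split; lra.
Qed.

End Dot.

(** * Derivatives along curves *)

Section Calculus.
Context {R : realType}.

Lemma derive_dot_grad n (F : 'rV[R]_n -> R) x v :
  differentiable F x -> 'D_v F x = dot (grad F x) v.
Proof.
move=> dF; rewrite deriveE // {1}(row_sum_delta v) linear_sum.
apply: eq_bigr => i _; rewrite linearZ /= -deriveE // /partial mxE.
by rewrite mulrC.
Qed.

Lemma is_derive_along n (F : 'rV[R]_n -> R) (c : R -> 'rV[R]_n) s dc :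
  differentiable F (c s) -> is_derive s 1 c dc ->
  is_derive s 1 (fun r => F (c r)) (dot (grad F (c s)) dc).
Proof.
move=> dF [dc1 dcE].
have dc2 : differentiable c s by apply/derivable1_diffP.
apply: DeriveDef; first exact/derivable1_diffP/differentiable_comp.
rewrite deriveE; last exact: differentiable_comp.
rewrite (_ : (fun r => _) = F \o c) // diff_comp //=.
by rewrite -(deriveE _ dc2) dcE -derive_dot_grad // deriveE.
Qed.

Lemma is_derive_line n (x v : 'rV[R]_n) (s : R) :
  is_derive s 1 (fun r => x + r *: v) v.
Proof.
have d1 : is_derive s 1 (fun r : R => r *: v) v.
  apply: DeriveDef; first exact/derivable1_diffP.
  by rewrite deriveE // (@diff_val _ _ _ _ _ _ _ (is_diff_scalel s v)) scale1r.
by have := is_deriveD (is_derive_cst x s 1) d1; rewrite add0r.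
Qed.

Lemma near_gt_of_derive_gt0 (h : R -> R) (a d : R) :
  is_derive a 1 h d -> 0 < d -> \forall s \near (0 : R)^'+, h a < h (a + s).
Proof.
move=> [dh dE] d0.
have := dh; rewrite /derivable.
move=> /cvg_ex[l hl].
have lE : l = d by rewrite -dE /derive; apply/esym/cvg_lim.
rewrite lE in hl.
have : \forall s \near (0 : R)^', 0 < s^-1 *: ((h \o shift a) (s *: 1) - h a).
  exact: (cvgr_gt _ hl).
rewrite !near_withinE => hh; near=> s => s0.
have : 0 < s^-1 *: ((h \o shift a) (s *: 1) - h a).
  have : s != 0 by rewrite gt_eqF.
  by move: s0 => _; near: s; exact: hh.
rewrite /= [_ *: 1]mulr1 [_ *: _]/(_ * _) pmulr_rgt0 ?invr_gt0 // subr_gt0.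
by rewrite addrC.
Unshelve. all: by end_near. Qed.

(** If the derivative d of h1 at 0 were positive, then h1 would be positive just
to the right of 0, and h would increase there by the mean value theorem. *)
Lemma second_derivative_test (h h1 : R -> R) (d : R) :
  (\forall s \near (0 : R), is_derive (s : R) 1 h (h1 s)) ->
  is_derive (0 : R) 1 h1 d ->
  (\forall s \near (0 : R), h s <= h 0) -> h1 0 = 0 /\ d <= 0.
Proof.
move=> dh dh1 hmax.
have [e /= e0 He] : \forall s \near (0 : R),
    is_derive (s : R) 1 h (h1 s) /\ h s <= h 0.
  by near=> s; split; near: s.
have {}He s : s \in `]-e, e[%R -> is_derive s 1 h (h1 s) /\ h s <= h 0.
  move=> /[!in_itv] /= ?; apply: He; rewrite /ball /= sub0r normrN.
  by rewrite ltr_norml.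
have e00 : 0 \in `]-e, e[%R by rewrite in_itv /= oppr_lt0 e0.
have h10 : h1 0 = 0.
  have : is_derive (0 : R) 1 h 0.
    apply: (@derive1_at_max _ h (-e) e) => //; first by lra.
      by move=> t /He[[]].
    by move=> t /He[].
  by move=> [_ D0]; have [[_ <-] _] := He _ e00.
split=> //; rewrite leNgt; apply/negP => d0.
have := near_gt_of_derive_gt0 dh1 d0; rewrite near_withinE h10.
move=> [e' /= e'0 He'].
pose s := Num.min e e' / 2.
have s0 : 0 < s by rewrite divr_gt0 // lt_min e0.
have [se se'] : s < e /\ s < e'.
  have m0 : 0 < Num.min e e' by rewrite lt_min e0.
  have : s < Num.min e e' by rewrite /s; lra.
  by rewrite lt_min => /andP.
have sub r : r \in `[0, s] -> r \in `]-e, e[%R.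
  by rewrite !in_itv /= => /andP[? ?]; apply/andP; split; lra.
have [c c0s cs] : exists2 c, c \in `]0, s[%R & h s - h 0 = h1 c * (s - 0).
  apply: MVT => //.
    by move=> r rs; apply: (He _ _).1; apply: sub; apply: subset_itv_oo_cc rs.
  apply: derivable_within_continuous => r rs.
  by case: (He _ (sub _ rs)) => -[].
move: c0s; rewrite in_itv /= => /andP[c0 c_s].
have := He' c; rewrite /ball /= sub0r normrN gtr0_norm // add0r => /(_ _ c0).
have ss : s \in `[0, s]%R by rewrite in_itv /= lexx ltW.
have [_ hs0] := He s (sub s ss); move=> h1c.
have {}h1c : 0 < h1 c by apply: h1c; lra.
have : 0 < h1 c * (s - 0) by rewrite mulr_gt0 // subr_gt0.
by rewrite -cs; lra.
Unshelve. all: by end_near. Qed.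

End Calculus.

(** * Hessians and the minimal graph operator *)

Section Hessian.
Context {R : realType} {n : nat}.
Implicit Types (F f g : 'rV[R]_n -> R) (D : set 'rV[R]_n) (c : R -> 'rV[R]_n).

Definition hess F x : 'M[R]_n := \matrix_(i, j) partial i (partial j F) x.

Lemma minimal_graph_opE F x :
  minimal_graph_op F x =
  \tr (hess F x) - bil (hess F x) (grad F x) (grad F x)
     / (1 + dot (grad F x) (grad F x)) + n%:R / F x.
Proof.
rewrite /minimal_graph_op enorm_sqr bil_sum; congr (_ - _ + _).
  by apply: eq_bigr => i _; rewrite mxE.
rewrite mulr_suml; apply: eq_bigr => i _; rewrite mulr_suml.
by apply: eq_bigr => j _; rewrite !mxE mulrAC.
Qed.

Lemma smooth_differentiable D F x : smooth_on D F -> D x -> differentiable F x.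
Proof. by move=> /(_ [::]); apply. Qed.

Lemma smooth_partial D F i x :
  smooth_on D F -> D x -> differentiable (partial i F) x.
Proof. by move=> /(_ [:: i]); apply. Qed.

Lemma is_derive_rV (u : R -> 'rV[R]_n) (s : R) (du : 'rV[R]_n) :
  is_derive s 1 u du <-> forall i, is_derive s 1 (fun r => u r 0 i) (du 0 i).
Proof.
split=> [[d1 d2] i|du0].
  move: (d1) => /derivable_mxP/(_ 0 i) d3; apply: DeriveDef => //.
  by rewrite -d2 derive_mx // mxE.
have d1 : derivable u s 1.
  by apply/derivable_mxP => i j; rewrite (ord1 i); case: (du0 j).
apply: DeriveDef => //; rewrite derive_mx //; apply/matrixP => i j.
by rewrite mxE (ord1 i); case: (du0 j).
Qed.

Lemma is_derive_dot (u v : R -> 'rV[R]_n) (s : R) (du dv : 'rV[R]_n) :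
  is_derive s 1 u du -> is_derive s 1 v dv ->
  is_derive s 1 (fun r => dot (u r) (v r)) (dot du (v s) + dot (u s) dv).
Proof.
move=> /is_derive_rV d1 /is_derive_rV d2.
have d3 i := is_deriveM (d1 i) (d2 i).
have := is_derive_sum d3; rewrite fct_sumE.
move=> /is_derive_eq; apply.
rewrite /dot -big_split /=; apply: eq_bigr => i _.
by rewrite /GRing.scale /=; ring.
Qed.

Lemma is_derive_grad D F c (s : R) dc :
  smooth_on D F -> D (c s) -> is_derive s 1 c dc ->
  is_derive s 1 (fun r => grad F (c r)) (dc *m hess F (c s)).
Proof.
move=> sF Dcs dc1; apply/is_derive_rV => i.
have -> : (fun r => grad F (c r) 0 i) = (fun r => partial i F (c r)).
  by apply/funext => r; rewrite mxE.
have := is_derive_along (smooth_partial i sF Dcs) dc1.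
move=> /is_derive_eq; apply; rewrite mxE; apply: eq_bigr => j _.
by rewrite !mxE mulrC.
Qed.

End Hessian.

(** * Two graphs cannot touch at a positive height *)

Section Touching.
Context {R : realType} {n : nat}.

Lemma is_derive_subZ (x : R -> 'rV[R]_n) (k : R -> R) (b dx : 'rV[R]_n)
    (s dk : R) :
  is_derive s 1 x dx -> is_derive s 1 k dk ->
  is_derive s 1 (fun r => x r - k r *: b) (dx - dk *: b).
Proof.
move=> /is_derive_rV d1 d2; apply/is_derive_rV => i.
have -> : (fun r => (x r - k r *: b) 0 i) =
    (fun r => x r 0 i) - (k * cst (b 0 i)).
  by apply/funext => r; rewrite !mxE.
apply: is_derive_eq.
by rewrite !mxE /GRing.scale /= mulr0 add0r mulrC.
Qed.

Lemma is_derive_sq (k : R -> R) (s dk : R) :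
  is_derive s 1 k dk -> is_derive s 1 (fun r => k r ^+ 2) (2 * k s * dk).
Proof.
move=> d1; have -> : (fun r => k r ^+ 2) = k ^+ 2 by [].
by apply: is_derive_eq; rewrite /GRing.scale /=; ring.
Qed.

(** The lifted graph of f cannot touch the hypersurface
q = g (x - (|x - x0|^2 + q^2) b) from above. Restricting the difference psi of
[touching_contradiction] to lines through xh gives the first and second order
conditions at its local maximum. The sign condition on
1 + 2 ft <grad g, b> says that the hypersurface is crossed downwards when the
height increases. *)
Lemma no_touching (D1 D2 : set 'rV[R]_n) (f g : 'rV[R]_n -> R)
    (x0 xh b : 'rV[R]_n) (c : R) :
  let ft x := f x + c in
  let A x := x - (dot (x - x0) (x - x0) + ft x ^+ 2) *: b in
  (0 < n)%N -> open D1 -> open D2 -> smooth_on D1 f -> smooth_on D2 g ->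
  D1 xh -> D2 (A xh) ->
  minimal_graph_op f xh = 0 -> minimal_graph_op g (A xh) = 0 ->
  0 < c -> 0 < f xh -> g (A xh) = ft xh ->
  0 <= 1 + 2 * ft xh * dot (grad g (A xh)) b ->
  dot (grad g (A xh)) (A xh - x0) = g (A xh) ->
  (forall u, bil (hess g (A xh)) (A xh - x0) u = 0) ->
  (forall u, bil (hess g (A xh)) u (A xh - x0) = 0) ->
  (\forall x \near xh, g (A x) <= ft x) ->
  False.
Proof.
move=> ft A n0 oD1 oD2 sf sg D1x D2A eqf eqg c0 f0 gA mu0 Eul QA AQ gmax.
pose P := grad f xh; pose G := grad g (A xh); pose t := ft xh.
pose Q := hess g (A xh); pose H := hess f xh; pose X := xh - x0.
pose drho := 2 *: X + (2 * t) *: P.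
have AE : A xh - x0 = X - (dot X X + t ^+ 2) *: b by rewrite /A addrAC.
have test v : dot G v - dot drho v * dot G b - dot P v = 0 /\
   (let w := v - dot drho v *: b in
     bil Q w w
     - dot G b * (2 * dot v v + 2 * dot P v ^+ 2 + 2 * t * bil H v v)
     - bil H v v <= 0).
  pose xs (s : R) := xh + s *: v.
  have xs0 : xs 0 = xh by rewrite /xs scale0r addr0.
  have dxs (s : R) : is_derive s 1 xs v by exact: is_derive_line.
  have dxs0 (s : R) : is_derive s 1 (fun s : R => xs s - x0) v.
    have -> : (fun s : R => xs s - x0) = (fun s => (xh - x0) + s *: v).
      by apply/funext => r; rewrite /xs addrAC.
    exact: is_derive_line.
  pose r1 s := 2 * dot (xs s - x0) v
     + 2 * ft (xs s) * dot (grad f (xs s)) v.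
  have dus (s : R) : D1 (xs s) ->
      is_derive s 1 (fun s : R => ft (xs s)) (dot (grad f (xs s)) v).
    move=> D1s; have d1 := is_derive_along (smooth_differentiable sf D1s) (dxs s).
    have := is_deriveD d1 (is_derive_cst c s 1).
    by rewrite addr0.
  have dAs (s : R) : D1 (xs s) ->
      is_derive s 1 (fun s => A (xs s)) (v - r1 s *: b).
    move=> D1s; apply: is_derive_subZ.
    have := is_deriveD (is_derive_dot (dxs0 s) (dxs0 s)) (is_derive_sq (dus s D1s)).
    by move=> /is_derive_eq; apply; rewrite /r1 (dotC v); ring.
  have contAt (F : R -> 'rV[R]_n) (dF : 'rV[R]_n) : is_derive (0 : R) (1 : R) F dF ->
      {for 0, continuous F}.
    by move=> [dF1 _]; apply/differentiable_continuous/derivable1_diffP.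
  have nD1 : \forall s \near (0 : R), D1 (xs s).
    have := contAt xs v (dxs 0); apply; rewrite xs0.
    exact: open_nbhs_nbhs.
  have D1x0 : D1 (xs 0) by rewrite xs0.
  have nD2 : \forall s \near (0 : R), D2 (A (xs s)).
    have := contAt _ _ (dAs 0 D1x0); apply; rewrite xs0.
    exact: open_nbhs_nbhs.
  pose h s := g (A (xs s)) - ft (xs s).
  pose h1 s := dot (grad g (A (xs s))) (v - r1 s *: b) - dot (grad f (xs s)) v.
  have dh : \forall s \near (0 : R), is_derive (s : R) 1 h (h1 s).
    near=> s.
    have D1s : D1 (xs s) by near: s.
    have D2s : D2 (A (xs s)) by near: s.
    apply: is_deriveB; last exact: dus.
    apply: is_derive_along; first exact: smooth_differentiable sg D2s.
    exact: dAs.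
  have dgf : is_derive (0 : R) 1 (fun s => dot (grad f (xs s)) v) (bil H v v).
    have := is_derive_dot (is_derive_grad sf D1x0 (dxs 0))
      (is_derive_cst v (0 : R) (1 : R)).
    move=> /is_derive_eq; apply; rewrite xs0 /bil -/H.
    by rewrite dotC dot0r addr0 dotC.
  have r10 : r1 0 = dot drho v.
    by rewrite /r1 xs0 /drho !dotE -/X -/P -/t.
  have dr1 : is_derive (0 : R) 1 r1
      (2 * dot v v + 2 * dot P v ^+ 2 + 2 * t * bil H v v).
    have d1 := is_derive_dot (dxs0 0) (is_derive_cst v (0 : R) (1 : R)).
    have d2 := is_deriveM (dus 0 D1x0) dgf.
    have d3 := is_deriveD (is_deriveZ (2 : R) d1) (is_deriveZ (2 : R) d2).
    have -> : r1 = 2 \*: (fun r => dot (xs r - x0) (cst v r)) +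
       2 \*: ((fun s : R => ft (xs s)) * (fun s => dot (grad f (xs s)) v)).
      by apply/funext => r; rewrite /r1 -mulrA.
    apply: is_derive_eq d3 _.
    rewrite xs0 dot0r /GRing.scale /= -/P -/t /cst; ring.
  have dh1 : is_derive (0 : R) 1 h1
     (bil Q (v - dot drho v *: b) (v - dot drho v *: b)
     - dot G b * (2 * dot v v + 2 * dot P v ^+ 2 + 2 * t * bil H v v)
     - bil H v v).
    apply: is_deriveB.
    have D2x0 : D2 (A (xs 0)) by rewrite xs0.
    have d1 := is_derive_grad sg D2x0 (dAs 0 D1x0).
    have d2 := is_derive_subZ b (is_derive_cst v (0 : R) (1 : R)) dr1.
    have := is_derive_dot d1 d2; move=> /is_derive_eq; apply.
    rewrite xs0 r10 -/Q -/G /bil /cst sub0r dotNr dotZr; ring.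
  have hmax : \forall s \near (0 : R), h s <= h 0.
    have -> : h 0 = 0 by rewrite /h xs0 gA subrr.
    have : \forall s \near (0 : R), g (A (xs s)) <= ft (xs s).
      apply: (contAt xs v (dxs 0) [set x | g (A x) <= ft x]).
      by rewrite xs0; exact: gmax.
    by apply: filterS => s; rewrite /h subr_le0.
  have [h10 d0] := second_derivative_test dh dh1 hmax.
  split=> //; rewrite -h10 /h1 xs0 r10 dotBr dotZr -/G -/P; ring.
apply: (@touching_contradiction R n Q H X b P G t c) => //.
- by rewrite /t /ft; lra.
- apply/eqP; rewrite -subr_eq0 -dot_eq0; apply/eqP.
  set z := G - _; have [+ _] := test z.
  have -> : dot z z = dot G z - (dot P z + dot G b * dot drho z).
    by rewrite -dotZl -dotDl -dotBl.
  by move=> <-; ring.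
- by rewrite -AE Eul gA.
- by move=> u; have := QA u; rewrite AE.
- by move=> u; have := AQ u; rewrite AE.
- by move: eqg; rewrite minimal_graph_opE gA.
- by move: eqf; rewrite minimal_graph_opE /t /ft addrK.
- by move=> v; have [_] := test v.
Unshelve. all: by end_near. Qed.

End Touching.

(** * Zero extension and crossings of the boundary *)

Section Topology.
Context {R : realType} {n : nat}.
Implicit Types (D O : set 'rV[R]_n).

Lemma cvg_dot {T : Type} (F : set_system T) {FF : Filter F}
    (u v : T -> 'rV[R]_n) (a b : 'rV[R]_n) :
  u @ F --> a -> v @ F --> b -> (fun x => dot (u x) (v x)) @ F --> dot a b.
Proof.
move=> ua vb; rewrite /dot; apply: cvg_big => [|i _]; first exact: add_continuous.
apply: cvgM.
  exact: (cvg_comp u (fun x : 'rV[R]_n => x 0 i) ua (@coord_continuous R 1 n 0 i a)).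
exact: (cvg_comp v (fun x : 'rV[R]_n => x 0 i) vb (@coord_continuous R 1 n 0 i b)).
Qed.

Lemma open_open_cone k (x0 : 'rV[R]_n) (nu : 'I_k -> 'rV[R]_n) :
  open (open_cone x0 nu).
Proof.
rewrite openE => x xV; rewrite /interior.
have : forall i, nbhs x (fun y => 0 < dot (y - x0) (nu i)).
  move=> i.
  have c : (fun y => dot (y - x0) (nu i)) @ x --> dot (x - x0) (nu i).
    exact: (cvg_dot (cvgB cvg_id (cvg_cst x0)) (cvg_cst (nu i))).
  exact: (cvgr_gt _ c).
by move=> /filter_forall.
Qed.

Lemma boundary_open D x : open D -> boundary D x <-> closure D x /\ ~ D x.
Proof. by move=> /interior_id oD; rewrite /boundary oD. Qed.

(** Extending a Dirichlet solution by 0 makes it continuous on the whole space,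
so that maxima can be taken over arbitrary compact sets; a point where the
extension is positive lies in the domain, and boundary cases disappear. *)
Definition zext D (f : 'rV[R]_n -> R) : 'rV[R]_n -> R := patch (fun=> 0) D f.

Lemma zext_in D f x : D x -> zext D f x = f x.
Proof. by move=> Dx; rewrite /zext patchT // inE. Qed.

Lemma zext_out D f x : ~ D x -> zext D f x = 0.
Proof. by move=> Dx; rewrite /zext /patch memNset. Qed.

Lemma near_open D x : open D -> D x -> \forall y \near x, D y.
Proof. by move=> oD Dx; exact: open_nbhs_nbhs. Qed.

Section ZeroExtension.
Variables (D : set 'rV[R]_n) (f : 'rV[R]_n -> R).
Hypotheses (oD : open D) (solf : dirichlet_solution D f).

Lemma zext_continuous : continuous (zext D f).
Proof.
have [cf sf _ _ fb] := solf => x.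
have [Dx|nDx] := pselect (D x).
  have cfx : {for x, continuous f}.
    exact: differentiable_continuous (smooth_differentiable sf Dx).
  rewrite /continuous_at zext_in //; apply: cvg_trans cfx.
  have e : \forall y \near x, f y = zext D f y.
    by apply: filterS (near_open oD Dx) => y Dy; rewrite zext_in.
  exact: near_eq_cvg e.
rewrite /continuous_at zext_out //.
have [cDx|ncDx] := pselect (closure D x); last first.
  have c0 : (fun _ : 'rV[R]_n => 0 : R) @ x --> (0 : R).
    exact: (@cvg_cst _ (0 : R) _ (nbhs x) _).
  have nc : \forall y \near x, (~` closure D) y.
    by apply: open_nbhs_nbhs; split => //; exact/closed_openC/closed_closure.
  have e : \forall y \near x, 0 = zext D f y.
    by apply: filterS nc => y ncy; rewrite zext_out // => /subset_closure.
  apply: cvg_trans c0; exact: near_eq_cvg e.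
have fx : f x = 0 by apply: fb; apply/boundary_open.
move/subspace_continuousP: cf => cf.
have {}cf : f @ within (closure D) (nbhs x) --> (0 : R).
  by rewrite -fx; exact: cf.
apply/(@cvgrPdist_lt _ _ _ (nbhs x)) => e e0; move/cvgrPdist_lt: cf => /(_ e e0).
rewrite near_withinE => {}cf; apply: filterS cf => y Hy.
have [Dy|nDy] := pselect (D y).
  by rewrite zext_in //; apply/Hy/subset_closure.
by rewrite zext_out // subrr normr0.
Qed.

Lemma zext_ge0 x : 0 <= zext D f x.
Proof.
have [_ _ _ f0 _] := solf; have [Dx|nDx] := pselect (D x).
  by rewrite zext_in // ltW // f0.
by rewrite zext_out.
Qed.

Lemma zext_gt0 x : 0 < zext D f x -> D x.
Proof. by move=> fx; apply: contrapT => nD; rewrite zext_out ?ltxx in fx. Qed.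

End ZeroExtension.

(** Otherwise the parameters whose point is in O would form a subset of [0, 1]
that is both open and closed. *)
Lemma segment_meets_boundary O (a b : 'rV[R]_n) :
  open O -> O a -> ~ O b ->
  exists2 t, 0 <= t <= 1 & boundary O (a + t *: (b - a)).
Proof.
move=> oO Oa nOb; apply: contrapT => nb.
pose c (t : R) := a + t *: (b - a).
have cc : continuous c.
  move=> t; apply: differentiable_continuous; apply/derivable1_diffP.
  by have [] := is_derive_line a (b - a) t.
have cO : `[0, 1] `&` c @^-1` O = `[0, 1] `&` c @^-1` (closure O).
  apply/seteqP; split => t [t01 /= Ot]; split => //.
    exact: subset_closure.
  apply: contrapT => nOt; apply: nb; exists t; first by move: t01; rewrite /= in_itv.
  exact/boundary_open.
have E : `[0, 1]%classic `&` c @^-1` O = `[0, 1]%classic.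
  apply: (@segment_connected R 0 1).
  - exists 0; split; last by rewrite /= /c scale0r addr0.
    by rewrite /= in_itv /= lexx ler01.
  - by exists (c @^-1` O) => //; apply: open_comp => // t _; exact: cc.
  - rewrite cO; exists (c @^-1` closure O) => //.
    by apply: preimage_closed (@closed_closure _ _) => t _; exact: cc.
have : (`[0%R, 1%R]%classic : set R) 1 by rewrite /= in_itv /= ler01 lexx.
by rewrite -E => -[_]; rewrite /= /c scale1r addrC subrK.
Qed.

End Topology.

(** * Comparison of solutions *)

Section Comparison.
Context {R : realType} {n : nat}.
Implicit Types (D : set 'rV[R]_n) (f g : 'rV[R]_n -> R).

Lemma closed_norm_ball (k : R) : closed [set x : 'rV[R]_n | `|x| <= k].
Proof.
apply: (@preimage_closed _ _ (fun x : 'rV[R]_n => `|x|) [set y : R | y <= k]).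
  by move=> x _; exact: norm_continuous.
exact: closed_le.
Qed.

Lemma compact_norm_ball (k : R) : compact [set x : 'rV[R]_n | `|x| <= k].
Proof.
apply: bounded_closed_compact; last exact: closed_norm_ball.
by exists k; split; [exact: num_real|move=> M kM x /le_trans; apply; exact: ltW].
Qed.

(** At a local maximum of f - g the gradients agree and the Hessian of f - g is
nonpositive, so its contraction with the common coefficient matrix is
nonpositive; but by the two equations that contraction is n / g - n / f, which
is positive when g < f. *)
Lemma no_interior_crossing D1 D2 f g (xh : 'rV[R]_n) :
  (0 < n)%N -> open D1 -> open D2 -> smooth_on D1 f -> smooth_on D2 g ->
  D1 xh -> D2 xh ->
  minimal_graph_op f xh = 0 -> minimal_graph_op g xh = 0 ->
  0 < g xh -> g xh < f xh ->
  ~ (\forall x \near xh, f x - g x <= f xh - g xh).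
Proof.
move=> n0 oD1 oD2 sf sg D1x D2x eqf eqg g0 gf fgmax.
pose P := grad f xh; pose H := hess f xh - hess g xh.
have test v : dot (grad f xh - grad g xh) v = 0 /\ bil H v v <= 0.
  pose xs (s : R) := xh + s *: v.
  have xs0 : xs 0 = xh by rewrite /xs scale0r addr0.
  have dxs (s : R) : is_derive s 1 xs v by exact: is_derive_line.
  have cxs : {for 0, continuous xs}.
    by case: (dxs 0) => dF1 _; apply/differentiable_continuous/derivable1_diffP.
  have nxs (A : set 'rV[R]_n) :
      (\forall x \near xh, A x) -> \forall s \near (0 : R), A (xs s).
    by move=> nA; apply: (cxs A); rewrite xs0.
  have nD1 := nxs _ (near_open oD1 D1x); have nD2 := nxs _ (near_open oD2 D2x).
  have [] := @second_derivative_test R (fun s => f (xs s) - g (xs s))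
    (fun s => dot (grad f (xs s)) v - dot (grad g (xs s)) v) (bil H v v).
  - near=> s.
    have D1s : D1 (xs s) by near: s.
    have D2s : D2 (xs s) by near: s.
    apply: is_deriveB; apply: is_derive_along => //.
      exact: smooth_differentiable sf D1s.
    exact: smooth_differentiable sg D2s.
  - have D1x0 : D1 (xs 0) by rewrite xs0.
    have D2x0 : D2 (xs 0) by rewrite xs0.
    have cv := is_derive_cst v (0 : R) (1 : R).
    have d1 := is_derive_dot (is_derive_grad sf D1x0 (dxs 0)) cv.
    have d2 := is_derive_dot (is_derive_grad sg D2x0 (dxs 0)) cv.
    have := is_deriveB d1 d2; move=> /is_derive_eq; apply.
    have -> : bil H v v = bil (hess f xh) v v - bil (hess g xh) v v.
      by rewrite /bil /H mulmxBr dotBl.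
    by rewrite xs0 !dot0r; congr (_ - _); exact: addr0.
  - rewrite xs0; exact: nxs fgmax.
  by rewrite xs0 dotBl.
have PG : grad g xh = P.
  apply/esym/eqP; rewrite -subr_eq0 -dot_eq0; apply/eqP.
  by case: (test (grad f xh - grad g xh)).
have trH : \tr H = \tr (hess f xh) - \tr (hess g xh) by rewrite /H linearB.
have bilH : bil H P P = bil (hess f xh) P P - bil (hess g xh) P P.
  by rewrite /bil /H mulmxBr dotBl.
have le0 := @trace_le0 R n H P (fun v => (test v).2).
rewrite trH bilH mulrBl opprD opprK addrACA in le0.
move: eqf eqg; rewrite !minimal_graph_opE PG -/P.
move=> /eqP; rewrite addr_eq0 => /eqP eqf /eqP; rewrite addr_eq0 => /eqP eqg.
rewrite eqf [- \tr _ + _]addrC -opprB eqg opprK in le0.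
have lt_inv : n%:R / f xh < n%:R / g xh.
  by rewrite ltr_pM2l ?ltr0n // ltf_pV2 // posrE // (lt_trans g0).
by move: le0; rewrite leNgt addrC subr_gt0 lt_inv.
Unshelve. all: by end_near. Qed.

(** A positive maximum of the difference of the zero extensions lies in D1, where
[no_interior_crossing] excludes it. *)
Lemma comparison D1 D2 f g :
  (0 < n)%N -> open D1 -> open D2 -> bounded_set D1 -> D1 `<=` D2 ->
  dirichlet_solution D1 f -> dirichlet_solution D2 g ->
  forall x, D1 x -> f x <= g x.
Proof.
move=> n0 oD1 oD2 bD1 D12 sf sg x D1x; rewrite leNgt; apply/negP => gf.
have [k k0 D1k] := ex_strict_bound_gt0 bD1.
pose K := [set x : 'rV[R]_n | `|x| <= k].
have D1K y : D1 y -> K y by move=> /D1k /= /ltW.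
pose F := zext D1 f; pose G := zext D2 g.
have cFG : continuous (fun y => F y - G y).
  move=> y.
  exact: (cvgB (@zext_continuous _ _ _ _ oD1 sf y)
    (@zext_continuous _ _ _ _ oD2 sg y)).
have [xh _ xmax] := compact_EVT_max (ex_intro _ x (D1K _ D1x))
  (@compact_norm_ball k) (continuous_subspaceT cFG).
have FGx : 0 < F xh - G xh.
  apply: lt_le_trans (xmax x _); last by rewrite inE; exact: D1K.
  by rewrite /= /F /G !zext_in ?subr_gt0 //; exact: D12.
have G0 : 0 <= G xh := zext_ge0 sg xh.
have F0 : 0 < F xh by lra.
have D1xh : D1 xh := zext_gt0 F0; have D2xh := D12 _ D1xh.
have [_ smf eqf posf _] := sf; have [_ smg eqg posg _] := sg.
move: FGx; rewrite /= /F /G !zext_in // subr_gt0 => fgxh.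
apply: (no_interior_crossing n0 oD1 oD2 smf smg D1xh D2xh
  (eqf _ D1xh) (eqg _ D2xh) (posg _ D2xh) fgxh).
apply: filterS (near_open oD1 D1xh) => y D1y.
have := xmax y; rewrite inE => /(_ (D1K _ D1y)).
by rewrite /= /F /G !zext_in //; exact: D12.
Qed.

End Comparison.

(** * Homogeneity of the solution in a cone *)

Lemma near_eq_differentiable (K : numFieldType) (V W : normedModType K)
    (f g : V -> W) (x : V) :
  (\forall y \near x, f y = g y) -> differentiable f x -> differentiable g x.
Proof.
move=> fg df; have fgx : f x = g x := nbhs_singleton fg.
have dg : g \o shift x = cst (g x) + 'd f x +o_ 0 id.
  apply/eqaddoP => e e0; have /eqaddoP/(_ e e0) := diff_locally df.
  have fg0 : \forall h \near (0 : V), f (h + x) = g (h + x).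
    by move: fg; rewrite (near_shift 0) subr0.
  by apply: filterS2 fg0 => h /= fgh; rewrite /= !fctE /= fgh fgx.
have dgE : 'd g x = 'd f x :> (_ -> _).
  by apply: diff_unique dg; exact: diff_continuous.
by apply/diff_locallyP; rewrite dgE; split=> //; exact: diff_continuous.
Qed.

Section Homogeneity.
Context {R : realType} {n : nat}.
Implicit Types (D : set 'rV[R]_n) (f g F : 'rV[R]_n -> R).

Variable x0 : 'rV[R]_n.

Definition dil (l : R) (z : 'rV[R]_n) := x0 + l *: (z - x0).

Lemma dil_sub l z : dil l z - x0 = l *: (z - x0).
Proof. by rewrite /dil addrC addKr. Qed.

Lemma dilK l : l != 0 -> cancel (dil l) (dil l^-1).
Proof. by move=> l0 z; rewrite /dil [X in _ *: X]dil_sub scalerK // addrC subrK. Qed.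

Lemma dil1 z : dil 1 z = z.
Proof. by rewrite /dil scale1r addrC subrK. Qed.

Lemma is_diff_dil l z : is_diff z (dil l) ( *:%R l).
Proof.
have d1 : is_diff z (fun y => y - x0) id.
  by have := is_diffB (is_diff_id z) (is_diff_cst x0 z); rewrite subr0.
have d2 := is_diffD (is_diff_cst x0 z) (is_diff_comp d1 (is_diff_scaler l (z - x0))).
by move: d2; rewrite add0r.
Qed.

Lemma dil_differentiable l z : differentiable (dil l) z.
Proof. by case: (is_diff_dil l z). Qed.

Lemma dil_continuous l : continuous (dil l).
Proof. by move=> z; exact/differentiable_continuous/dil_differentiable. Qed.

Lemma partial_dil F l c z i : differentiable F (dil l z) ->
  partial i (fun y => c * F (dil l y)) z = c * l * partial i F (dil l z).
Proof.
move=> dF; have dl := is_diff_dil l z.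
have dFl : differentiable (F \o dil l) z by exact: differentiable_comp.
rewrite /partial (_ : (fun y => _) = c *: (F \o dil l)) //.
rewrite deriveZ; last exact: diff_derivable.
rewrite deriveE // diff_comp // [in LHS]/= diff_val -[X in _ *: X]deriveE //.
by rewrite !derive_dot_grad // dotZr [LHS]mulrA.
Qed.

Variable V : set 'rV[R]_n.
Hypothesis oV : open V.
Hypothesis dilV : forall l z, 0 < l -> V z -> V (dil l z).

Section Scaling.
Variables (g : 'rV[R]_n -> R) (l : R).
Hypothesis l0 : 0 < l.
Hypothesis sg : smooth_on V g.
Let gl z := l^-1 * g (dil l z).

(** Each derivative of z |-> g (dil l z) / l produces one factor l; as V is open,
an identity between functions on V can be differentiated again. *)
Lemma partials_dil s z : V z ->
  foldr (@partial R n) gl s z =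
  l^-1 * l ^+ size s * foldr (@partial R n) g s (dil l z).
Proof.
elim: s z => [|i s IH] z Vz; first by rewrite /= mulr1.
rewrite [LHS]/= /partial (@near_eq_derive _ _ _ _
  (fun y => l^-1 * l ^+ size s * foldr (@partial R n) g s (dil l y))).
  rewrite -/(partial i _ z) partial_dil; last by apply: sg; exact: dilV.
  by rewrite /= exprSr mulrA.
by apply: filterS (near_open oV Vz) => y; exact: IH.
Qed.

Lemma smooth_on_dil : smooth_on V gl.
Proof.
move=> s z Vz; apply: (@near_eq_differentiable _ _ _
  (fun y => l^-1 * l ^+ size s * foldr (@partial R n) g s (dil l y))).
  by apply: filterS (near_open oV Vz) => y /partials_dil.
rewrite (_ : (fun y => _) =
  (l^-1 * l ^+ size s) *: (foldr (@partial R n) g s \o dil l)) //.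
apply: differentiableZ; apply: differentiable_comp; first exact: dil_differentiable.
by apply: sg; exact: dilV.
Qed.

Lemma grad_dil z : V z -> grad gl z = grad g (dil l z).
Proof.
move=> Vz; apply/rowP => i; rewrite !mxE.
have /= -> := partials_dil [:: i] Vz.
by rewrite expr1 mulVf ?mul1r // gt_eqF.
Qed.

Lemma hess_dil z : V z -> hess gl z = l *: hess g (dil l z).
Proof.
move=> Vz; apply/matrixP => i j; rewrite !mxE.
have /= -> := partials_dil [:: i; j] Vz.
by rewrite expr2 [_^-1 * _]mulrA mulVf ?mul1r // gt_eqF.
Qed.

End Scaling.

Hypothesis dil_boundary : forall l z, 0 < l -> boundary V z -> boundary V (dil l z).

Lemma dil_closure l z : 0 < l -> closure V z -> closure V (dil l z).
Proof.
move=> l0 cz; have [Vz|nVz] := pselect (V z).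
  exact/subset_closure/dilV.
have bz : boundary V z by exact/boundary_open.
by have /boundary_open[] := dil_boundary l0 bz.
Qed.

(** The gradient is unchanged by the scaling, and both the Hessian and 1 / g are
multiplied by l, so the operator is multiplied by l. *)
Lemma dirichlet_solution_dil g l : 0 < l -> dirichlet_solution V g ->
  dirichlet_solution V (fun z => l^-1 * g (dil l z)).
Proof.
move=> l0 [cg sg eqg posg bg]; split.
- apply/subspace_continuousP => z cz; apply: cvgM; first exact: cvg_cst.
  move/subspace_continuousP: cg => /(_ (dil l z) (dil_closure l0 cz)) cg.
  apply: cvg_trans cg => A /=; rewrite /= !nbhs_simpl /= => HA.
  have := dil_continuous HA; rewrite /= !nbhs_simpl /within /=.
  by apply: filterS => y H cy; apply: H; exact: dil_closure.
- exact: smooth_on_dil.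
- move=> z Vz; rewrite minimal_graph_opE hess_dil // grad_dil //.
  rewrite linearZ /= /bil -scalemxAr dotZl -/(bil _ _ _).
  have := eqg _ (dilV l0 Vz); rewrite minimal_graph_opE => e.
  by rewrite -[RHS](mulr0 l) -e !mulrDr mulrN mulrA invfM invrK mulrCA.
- by move=> z Vz; rewrite mulr_gt0 ?invr_gt0 //; apply: posg; exact: dilV.
- by move=> z bz; rewrite bg ?mulr0 //; exact: dil_boundary.
Qed.

Variable g : 'rV[R]_n -> R.
Hypothesis solg : the_dirichlet_solution V g.

(** The rescaled solution solves the same problem, hence is g by uniqueness. *)
Lemma homogeneous l z : 0 < l -> V z -> g (dil l z) = l * g z.
Proof.
move=> l0 Vz; have [sg ug] := solg.
rewrite -(ug _ (dirichlet_solution_dil l0 sg) z (subset_closure Vz)).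
by rewrite mulrA divff ?mul1r // gt_eqF.
Qed.

Lemma grad_homogeneous l z : 0 < l -> V z -> grad g (dil l z) = grad g z.
Proof.
move=> l0 Vz; have [[_ sg _ _ _] _] := solg.
rewrite -(grad_dil l0 sg Vz); apply/rowP => i; rewrite !mxE.
apply: near_eq_derive; apply: filterS (near_open oV Vz) => y Vy.
by rewrite homogeneous // mulKf // gt_eqF.
Qed.

Lemma is_derive_dil z : is_derive (1 : R) 1 (dil ^~ z) (z - x0).
Proof. exact: is_derive_line. Qed.

Lemma euler_identity z : V z -> dot (grad g z) (z - x0) = g z.
Proof.
move=> Vz; have [[_ sg _ _ _] _] := solg.
have dg : differentiable g (dil 1 z).
  by rewrite dil1; exact: smooth_differentiable sg Vz.
have [_ d1] := is_derive_along dg (is_derive_dil z).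
rewrite -[X in grad g X]dil1 -d1.
rewrite (@near_eq_derive _ _ _ _ (fun l : R => l * g z)).
  have -> : (fun l : R => l * g z) = g z \*: id.
    by apply/funext => l; rewrite /= mulrC.
  by rewrite derive_val /GRing.scale /= mulr1.
near=> l; apply: homogeneous => //; near: l; exact: lt_nbhsr.
Unshelve. all: by end_near. Qed.

(** The gradient is constant along rays. *)
Lemma hess_euler_l z u : V z -> bil (hess g z) (z - x0) u = 0.
Proof.
move=> Vz; have [[_ sg _ _ _] _] := solg.
suff e : (z - x0) *m hess g z = 0 by rewrite /bil e dot0l.
have V1 : V (dil 1 z) by rewrite dil1.
have [_ d1] := is_derive_grad sg V1 (is_derive_dil z).
rewrite -[X in hess g X]dil1 -d1.
rewrite (@near_eq_derive _ _ _ _ (fun _ : R => grad g z)) ?derive_cst //.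
near=> l; apply: grad_homogeneous => //; near: l; exact: lt_nbhsr.
Unshelve. all: by end_near. Qed.

(** Obtained by differentiating the Euler identity in the direction u. *)
Lemma hess_euler_r z u : V z -> bil (hess g z) u (z - x0) = 0.
Proof.
move=> Vz; have [[_ sg _ _ _] _] := solg.
pose c (r : R) := z + r *: u.
have c0 : c 0 = z by rewrite /c scale0r addr0.
have dc : is_derive (0 : R) 1 c u by exact: is_derive_line.
have dcx : is_derive (0 : R) 1 (fun r => c r - x0) u.
  have -> : (fun r => c r - x0) = (fun r => (z - x0) + r *: u).
    by apply/funext => r; rewrite /c addrAC.
  exact: is_derive_line.
have Vc : V (c 0) by rewrite c0.
have [_ d1] := is_derive_along (smooth_differentiable sg Vc) dc.
have [_ d2] := is_derive_dot (is_derive_grad sg Vc dc) dcx.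
have : 'D_1 (fun r => g (c r)) 0 = 'D_1 (fun r => dot (grad g (c r)) (c r - x0)) 0.
  apply: near_eq_derive.
  have : \forall r \near (0 : R), V (c r).
    have cc : {for 0, continuous c}.
      by case: dc => dc1 _; apply/differentiable_continuous/derivable1_diffP.
    by apply: (cc V); rewrite c0; exact: near_open.
  by apply: filterS => r Vr; rewrite euler_identity.
rewrite d1 d2 c0 -/(bil _ _ _) => e.
by apply: (addIr (dot (grad g z) u)); rewrite -e add0r.
Qed.

End Homogeneity.

(** * The inverted and translated cone solution as a lower barrier *)

Section Barrier.
Context {R : realType} {n : nat}.
Variables (x0 b : 'rV[R]_n).

(** First component, up to the dilation by |x - x0|^2 + q^2, of the composition of
the inversion at (x0, 0) with the translation by - b. For a solution g that is
homogeneous about x0, the inverse of that composition therefore maps the graph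
of g to the hypersurface q = g (mob x q). *)
Definition mob (x : 'rV[R]_n) (q : R) : 'rV[R]_n :=
  x - (dot (x - x0) (x - x0) + q ^+ 2) *: b.

Lemma cvg_mob {T : Type} (F : set_system T) {FF : Filter F}
    (u : T -> 'rV[R]_n) (v : T -> R) x q :
  u @ F --> x -> v @ F --> q -> (fun t => mob (u t) (v t)) @ F --> mob x q.
Proof.
move=> ux vq.
have ux0 : (fun t => u t - x0) @ F --> x - x0.
  exact: (cvgB ux (cvg_cst x0)).
have c1 : (fun t => dot (u t - x0) (u t - x0) + v t ^+ 2) @ F -->
    dot (x - x0) (x - x0) + q ^+ 2.
  exact: (cvgD (cvg_dot ux0 ux0) (cvgM vq vq)).
exact: (cvgB ux (cvgZ c1 (cvg_cst b))).
Qed.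

Variables (V Omega : set 'rV[R]_n) (f g : 'rV[R]_n -> R) (k : R).
Hypotheses (n0 : (0 < n)%N) (oV : open V) (oO : open Omega).
Hypothesis dilV : forall l z, 0 < l -> V z -> V (dil x0 l z).
Hypothesis dil_boundary :
  forall l z, 0 < l -> boundary V z -> boundary V (dil x0 l z).
Hypothesis solf : dirichlet_solution Omega f.
Hypothesis solg : the_dirichlet_solution V g.
Hypothesis mobO : forall x q, V (mob x q) -> Omega x.
Hypothesis mobK : forall x q, V (mob x q) -> `|x| <= k /\ q < k.

(** If the claim fails, lift the graph of f to the last height f + c, c > 0, at
which it meets the set q <= g (mob x q); the set of pairs (x, q) is compact
because mob x q leaves V when x or q is large. Contact takes place at an
interior point, at equality, and with the lifted graph above; since no point
further up satisfies the inequality, the hypersurface is crossed downwards.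
This is what [no_touching] excludes. *)
Lemma mobius_barrier x q : V (mob x q) -> q <= g (mob x q) -> q <= f x.
Proof.
move=> Vx1 gx1; rewrite leNgt; apply/negP => fx1.
have [_ smf eqf posf _] := solf; have [sg _] := solg.
have [_ smg eqg posg _] := sg.
pose F := zext Omega f; pose G := zext V g.
have cF : continuous F := zext_continuous oO solf.
have cG : continuous G := zext_continuous oV sg.
have cGm (T : Type) (FT : set_system T) (u : T -> 'rV[R]_n) (v : T -> R) y r :
    Filter FT -> u @ FT --> y -> v @ FT --> r ->
    (fun t => G (mob (u t) (v t)) - v t) @ FT --> G (mob y r) - r.
  move=> FF uy vr; apply: cvgB => //.
  exact: (cvg_comp _ _ (cvg_mob uy vr) (cG (mob y r))).
have q0 : 0 < q by apply: lt_trans fx1; apply/posf/mobO/Vx1.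
(* The compact set of competitors for the largest lift. *)
pose K := [set y : 'rV[R]_n | `|y| <= k] `*` `[0, k]%classic.
have cK : compact K.
  by apply: compact_setX; [exact: compact_norm_ball|exact: segment_compact].
pose D := K `&` [set p : 'rV[R]_n * R | 0 <= G (mob p.1 p.2) - p.2].
have cD : compact D.
  apply: compact_closedI => //.
  apply: (@preimage_closed _ _ (fun p => G (mob p.1 p.2) - p.2)
    [set y : R | 0 <= y]).
    by move=> p _; apply: cGm; [exact: cvg_fst|exact: cvg_snd].
  exact: closed_ge.
have inD y r : V (mob y r) -> 0 <= r -> r <= g (mob y r) -> D (y, r).
  move=> Vy r0 rg; have [yk rk] := mobK Vy; split.
    by split => //=; rewrite in_itv /= r0 ltW.
  by rewrite /= /G zext_in // subr_ge0.
have cobj : continuous (fun p : 'rV[R]_n * R => p.2 - F p.1).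
  move=> p; apply: cvgB; first exact: cvg_snd.
  by apply: cvg_comp; [exact: cvg_fst|exact: cF].
have [[xh qh]] := compact_EVT_max (ex_intro _ _ (inD _ _ Vx1 (ltW q0) gx1)) cD
  (continuous_subspaceT cobj).
rewrite inE => -[[/= _ _] /= Gq] max.
have {}max y r : V (mob y r) -> 0 <= r -> r <= g (mob y r) ->
    r - f y <= qh - F xh.
  move=> Vy r0 rg; have := max (y, r); rewrite inE /= /F (zext_in _ (mobO Vy)).
  by apply; exact: inD.
have c0 : 0 < qh - F xh.
  by apply: lt_le_trans (max _ _ Vx1 (ltW q0) gx1); rewrite subr_gt0.
have F0 : 0 <= F xh := zext_ge0 solf xh.
have qh0 : 0 < qh by lra.
have Vh : V (mob xh qh) by apply: (@zext_gt0 _ _ V g); rewrite -/G; lra.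
have Oh := mobO Vh.
rewrite /F zext_in // in max c0 F0; rewrite /G zext_in // subr_ge0 in Gq.
pose c := qh - f xh; rewrite -/c in max c0.
pose ft y := f y + c.
have fth : ft xh = qh by rewrite /ft /c addrC subrK.
(* By maximality of c nothing on or above the lifted graph satisfies the strict
   inequality, as it would persist at a slightly larger height. *)
have C1 y : 0 < ft y -> V (mob y (ft y)) -> g (mob y (ft y)) <= ft y.
  move=> ft0 Vy; rewrite leNgt; apply/negP => gt.
  have : (fun r => G (mob y r) - r) @ ft y --> G (mob y (ft y)) - ft y.
    by apply: cGm; [exact: cvg_cst|exact: cvg_id].
  move=> /cvgr_gt /(_ 0); rewrite {1}/G zext_in // subr_gt0 => /(_ gt) H.
  have /nbhs_ballP[e /= e0 He] := H.
  have gtr : ft y + e / 2 < G (mob y (ft y + e / 2)).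
    rewrite -subr_gt0; apply: He; rewrite /ball /= opprD addNKr normrN.
    by rewrite gtr0_norm ?divr_gt0 //; lra.
  have Vr : V (mob y (ft y + e / 2)).
    by apply: (@zext_gt0 _ _ V g); apply: lt_trans gtr; lra.
  rewrite /G zext_in // in gtr.
  have r0 : 0 <= ft y + e / 2 by lra.
  by have := max y (ft y + e / 2) Vr r0 (ltW gtr); rewrite /ft; lra.
have ghE : g (mob xh qh) = qh.
  by apply/eqP; rewrite eq_le Gq andbT -fth; apply: C1; rewrite fth.
pose gam := dot (grad g (mob xh qh)) b.
(* Minus this number is the derivative of q |-> g (mob xh q) - q at qh. *)
have mu0 : 0 <= 1 + 2 * qh * gam.
  rewrite leNgt; apply/negP => mu0.
  have dmob : is_derive qh 1 (mob xh) (0 - (2 * qh) *: b).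
    have d0 : is_derive qh 1 (fun r => dot (xh - x0) (xh - x0) + r ^+ 2) (2 * qh).
      have := is_deriveD (is_derive_cst (dot (xh - x0) (xh - x0)) qh 1)
        (is_derive_sq (is_derive_id qh (1 : R))).
      by rewrite add0r mulr1.
    exact: (is_derive_subZ b (is_derive_cst xh qh (1 : R)) d0).
  have d1 := is_derive_along (smooth_differentiable smg Vh) dmob.
  have d2 := is_deriveB d1 (is_derive_id qh 1).
  have H := near_gt_of_derive_gt0 d2; rewrite sub0r dotNr dotZr -/gam in H.
  have nV : \forall s \near (0 : R), V (mob xh (qh + s)).
    have : (fun s => mob xh (qh + s)) @ (0 : R) --> mob xh qh.
      apply: cvg_mob; first exact: cvg_cst.
      by rewrite -[X in _ --> X]addr0; apply: cvgD; [exact: cvg_cst|exact: cvg_id].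
    by apply; exact: near_open.
  have H2 : \forall s \near 0^'+, V (mob xh (qh + s)) /\ 0 < s /\
      g (mob xh qh) - qh < g (mob xh (qh + s)) - (qh + s).
    near=> s; split; first by near: s; exact: cvg_within nV.
    split; near: s; first exact: nbhs_right_gt.
    by apply: H; lra.
  have [s [Vs [s0]]] := filter_ex H2.
  rewrite ghE subrr subr_gt0 => /ltW gs.
  have qs0 : 0 <= qh + s by lra.
  by have := max xh (qh + s) Vs qs0 gs; rewrite /c; lra.
have cfh : f @ xh --> f xh.
  exact: differentiable_continuous (smooth_differentiable smf Oh).
have cft : ft @ xh --> ft xh by exact: (cvgD cfh (cvg_cst c)).
have nV : \forall y \near xh, V (mob y (ft y)).
  have Vft : V (mob xh (ft xh)) by rewrite fth.
  have cm : (fun y => mob y (ft y)) @ xh --> mob xh (ft xh).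
    apply: (@cvg_mob _ (nbhs xh) _ id ft xh (ft xh)); last exact: cft.
    exact: cvg_id.
  exact: (cm V (near_open oV Vft)).
have nf : \forall y \near xh, 0 < ft y 
  by apply: (cvgr_gt _ cft); have := qh0; rewrite -[X in _ < X]fth.
have loc : \forall y \near xh, g (mob y (ft y)) <= ft y.
  by apply: filterS2 nV nf => y Vy fy; exact: C1.
have eul := euler_identity oV dilV dil_boundary solg Vh.
have hel u := hess_euler_l oV dilV dil_boundary solg u Vh.
have her u := hess_euler_r oV dilV dil_boundary solg u Vh.
have eqfh := eqf _ Oh; have eqgh := eqg _ Vh; have posh := posf _ Oh.
rewrite /gam -fth in Vh eqgh ghE mu0 eul hel her.
exact: (@no_touching R n Omega V f g x0 xh b c n0 oO oV smf smg Oh Vh eqfh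
  eqgh c0 posh ghE mu0 eul hel her loc).
Unshelve. all: by end_near. Qed.

End Barrier.

(** * The tangent cone and the domain near its vertex *)

Section Geometry.
Context {R : realType} {n : nat}.
Implicit Types (x y z u v : 'rV[R]_n).

Lemma coord_le_norm v i : `|v 0 i| <= `|v|.
Proof.
rewrite [leRHS]/Num.norm /= mx_normrE.
by apply/bigmax_geP; right => /=; exists (0, i).
Qed.

Lemma norm_le_enorm v : `|v| <= enorm v.
Proof.
have [->|v0] := eqVneq `|v| 0; first exact: enorm_ge0.
have [i vi] := mx_norm_neq0 v0; have -> : `|v| = `|v i.1 i.2| := vi.
rewrite -sqrtr_sqr ler_wsqrtr // (ord1 i.1) /dot (bigD1 i.2) //= -expr2.
by rewrite lerDl sumr_ge0 // => j _; rewrite -expr2 sqr_ge0.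
Qed.

Lemma dot_le_norm u v : dot u v <= n%:R * (`|u| * `|v|).
Proof.
apply: le_trans (ler_norm _) _; apply: le_trans (ler_norm_sum _ _ _) _.
rewrite mulr_natl -[X in _ *+ X]card_ord -sumr_const; apply: ler_sum => i _.
by rewrite normrM ler_pM // coord_le_norm.
Qed.

(** By the mean value theorem along the segment from x0 to x, on the ends of which
rho vanishes, the gradient of rho at some intermediate point is orthogonal to
x - x0, and the gradient at x0 differs from it by O(|x - x0|). *)
Lemma C11_tangent (S : set 'rV[R]_n) (x0 nu : 'rV[R]_n) :
  S x0 -> unit_normal S x0 nu ->
  exists2 L : R, 0 < L & forall x, S x -> enorm (x - x0) < L^-1 ->
    dot (x - x0) nu <= L * dot (x - x0) (x - x0).
Proof.
move=> Sx0 [_ [U [rho [c [[[oU Ux0] [drho lip] _ rho0 _] ->]]]]].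
have [M [M0 lipM]] : exists M : R, 0 < M /\ forall x y, U x -> U y ->
    `|grad rho x - grad rho y| <= M * `|x - y|.
  have [M [Mr HM]] := lip; exists (`|M| + 1); split.
    by rewrite ltr_wpDl.
  move=> x y Ux Uy; apply: (HM (`|M| + 1) _ (x, y)) => //=.
  by rewrite (le_lt_trans (ler_norm _)) // ltrDl.
have /nbhs_ballP[e /= e0 He] : nbhs x0 U by exact: near_open.
pose L := `|c| * (n%:R * M) + e^-1.
have nM0 : 0 <= n%:R * M by rewrite mulr_ge0 // ltW.
have L0 : 0 < L by rewrite ltr_wpDl ?mulr_ge0 ?invr_gt0 // ltW.
exists L => // x Sx xL.
have eL : L^-1 <= e.
  rewrite -[leRHS]invrK lef_pV2 ?posrE ?invr_gt0 //.
  by rewrite /L lerDr mulr_ge0 // ltW.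
have xe : `|x - x0| < e.
  by apply: le_lt_trans (norm_le_enorm _) _; apply: lt_le_trans eL.
pose w := x - x0; pose l (s : R) := x0 + s *: w.
have lU s : 0 <= s <= 1 -> U (l s).
  move=> /andP[s0 s1]; apply: He; rewrite -ball_normE /= /l opprD addNKr normrN.
  rewrite normrZ ger0_norm //; apply: le_lt_trans xe.
  by rewrite ler_piMl.
have dl (s : R) : 0 <= s <= 1 ->
    is_derive s 1 (fun r => rho (l r)) (dot (grad rho (l s)) w).
  by move=> /lU Us; apply: is_derive_along; [exact: drho|exact: is_derive_line].
have [s s01] : exists2 s, s \in `]0, 1[%R &
    rho (l 1) - rho (l 0) = dot (grad rho (l s)) w * (1 - 0).
  apply: (@MVT R (fun r => rho (l r)) (fun s => dot (grad rho (l s)) w)) => //.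
    by move=> s; rewrite in_itv /= => /andP[? ?]; apply: dl; rewrite !ltW.
  apply: derivable_within_continuous => s; rewrite in_itv /= => s01.
  by case: (dl _ s01).
have Ul1 : U (l 1) by apply: lU; rewrite ler01 lexx.
have l1 : l 1 = x by rewrite /l scale1r addrC subrK.
have l0 : l 0 = x0 by rewrite /l scale0r addr0.
rewrite {}l1 in Ul1 *; rewrite l0 (rho0 _ Ul1 Sx) (rho0 _ Ux0 Sx0) !subr0 mulr1.
move=> /esym gs; rewrite -/w.
move: s01; rewrite in_itv /= => /andP[s0 s1].
have Us : U (l s) by apply: lU; rewrite !ltW.
have -> : dot w (c *: grad rho x0) = dot (c *: (grad rho x0 - grad rho (l s))) w.
  by rewrite dotC !dotZl dotBl gs subr0.
apply: le_trans (dot_le_norm _ _) _.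
apply: (@le_trans _ _ (`|c| * (n%:R * M) * dot w w)); last first.
  by apply: ler_wpM2r; rewrite ?dot_ge0 // /L lerDl invr_ge0 ltW.
rewrite normrZ -enorm_sqr expr2.
have h1 : `|grad rho x0 - grad rho (l s)| <= M * `|w|.
  apply: le_trans (lipM _ _ Ux0 Us) _; rewrite /l opprD addNKr normrN normrZ.
  rewrite gtr0_norm // ler_pM2l // ler_piMl // ltW //.
have h2 := norm_le_enorm w.
have -> : n%:R * (`|c| * `|grad rho x0 - grad rho (l s)| * `|w|) =
  (`|c| * n%:R) * (`|grad rho x0 - grad rho (l s)| * `|w|) by ring.
have -> : `|c| * (n%:R * M) * (enorm w * enorm w) =
  (`|c| * n%:R) * (M * enorm w * enorm w) by ring.
apply: ler_wpM2l; first by rewrite mulr_ge0.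
apply: ler_pM => //; apply: le_trans h1 _.
by rewrite ler_pM2l.
Qed.

(** The point x0 need not lie in O. Write the given point as a convex combination
of some z in O close to x0 and of h z, which tends to p as z tends to x0. *)
Lemma open_convex_segment (O : set 'rV[R]_n) x0 p s :
  open O -> @convex_set R 'rV[R]_n O -> closure O x0 -> O p ->
  0 < s <= 1 -> O (x0 + s *: (p - x0)).
Proof.
move=> oO cO clO Op /andP[s0 s1].
have [->|s1'] := eqVneq s 1; first by rewrite scale1r addrC subrK.
have {s1 s1'} s1 : s < 1 by rewrite lt_neqAle s1' s1.
pose h z := p - ((1 - s) / s) *: (z - x0).
have hx0 : h x0 = p by rewrite /h subrr scaler0 subr0.
have ch : h @ x0 --> h x0.
  have c1 : (fun z => z - x0) @ x0 --> x0 - x0.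
    exact: (cvgB cvg_id (cvg_cst x0)).
  exact: (cvgB (cvg_cst p) (cvgZ (cvg_cst ((1 - s) / s)) c1)).
have nO : nbhs x0 (h @^-1` O).
  by apply: ch; rewrite hx0; exact: near_open.
have [z [Oz Ohz]] := clO _ nO.
have s01 : 0 <= s <= 1 by rewrite !ltW.
have := cO (h z) z (Itv01 (ltW s0) (ltW s1)) (mem_set Ohz) (mem_set Oz).
rewrite inE; congr O.
rewrite /conv /= /h; apply/rowP => i; rewrite !mxE /= /unstable.onem; field.
by rewrite gt_eqF.
Qed.

(** Moving from x by <x - x0, nu> in the direction - nu reaches the hyperplane
through x0, which lies outside O, so the boundary is met on the way. *)
Lemma dist_boundary_le (O : set 'rV[R]_n) x0 nu x d :
  open O -> (forall y, O y -> 0 < dot (y - x0) nu) -> enorm nu = 1 ->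
  O x -> d <= dist_set x (boundary O) -> d <= dot (x - x0) nu.
Proof.
move=> oO Onu nu1 Ox /le_trans; apply.
set s := dot (x - x0) nu; have s0 : 0 < s := Onu _ Ox.
have nOy : ~ O (x - s *: nu).
  move=> /Onu; have -> : x - s *: nu - x0 = (x - x0) - s *: nu by rewrite addrAC.
  by rewrite dotBl dotZl -enorm_sqr nu1 expr1n mulr1 -/s subrr ltxx.
have [t /andP[t0 t1] bt] := segment_meets_boundary oO Ox nOy.
apply: (@le_trans _ _ (enorm (x - (x + t *: (x - s *: nu - x))))).
  apply: ge_inf; last by exists (x + t *: (x - s *: nu - x)).
  by exists 0 => _ [z _ <-]; exact: enorm_ge0.
have -> : x - (x + t *: (x - s *: nu - x)) = (t * s) *: nu.
  by apply/rowP => i; rewrite !mxE; ring.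
rewrite enormZ nu1 mulr1 ger0_norm; last by rewrite mulr_ge0 // ltW.
by rewrite ler_piMl // ltW.
Qed.

(** The region defined by the last hypothesis is convex, and misses the boundary of
O because of the tangency hypothesis; it contains points of O, namely those of a
segment from x0 into O that are close to x0. A segment inside the region cannot
leave O. The bound on |x - x0| holds since <x - x0, nu_i> <= |x - x0|. *)
Lemma cusp_inside (k : nat) (O : set 'rV[R]_n) (x0 : 'rV[R]_n) (rad L : R)
    (S : 'I_k -> set 'rV[R]_n) (nu : 'I_k -> 'rV[R]_n) (i0 : 'I_k) :
  bounded_convex_domain O -> boundary O x0 ->
  boundary O `&` eball x0 rad = \bigcup_i S i ->
  (forall i x, O x -> 0 < dot (x - x0) (nu i)) ->
  (forall i, enorm (nu i) = 1) -> 0 < L -> L^-1 <= rad ->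
  (forall i x, S i x -> enorm (x - x0) < L^-1 ->
     dot (x - x0) (nu i) <= L * dot (x - x0) (x - x0)) ->
  forall x, (forall i, L * dot (x - x0) (x - x0) < dot (x - x0) (nu i)) ->
    enorm (x - x0) < L^-1 /\ O x.
Proof.
move=> [oO [p Op] cO _] bO bS Onu nu1 L0 Lrad tang.
pose G x := forall i, L * dot (x - x0) (x - x0) < dot (x - x0) (nu i).
have GL x : G x -> enorm (x - x0) < L^-1.
  move=> /(_ i0) Gx; have := lt_le_trans Gx (dot_unit_le (x - x0) (nu1 i0)).
  have [e0|e0] := eqVneq (enorm (x - x0)) 0; first by rewrite e0 invr_gt0.
  have {}e0 : 0 < enorm (x - x0) by rewrite lt_def e0 enorm_ge0.
  rewrite -enorm_sqr expr2 mulrA gtr_pMl // => Le.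
  by rewrite -[L^-1]mul1r ltr_pdivlMr // mulrC.
move=> x Gx; split; first exact: GL.
pose w := p - x0.
have [s [s01 Gs]] : exists s, 0 < s <= 1 /\ G (x0 + s *: w).
  have wnu i : 0 < dot w (nu i) by exact: Onu.
  have ws i : \forall s \near (0 : R)^'+, L * (s * dot w w) < dot w (nu i).
    have c : (fun s : R => L * (s * dot w w)) @ (0 : R)^'+ --> L * (0 * dot w w).
      apply: cvg_at_right_filter.
      by apply: cvgM; [exact: cvg_cst|apply: cvgM; [exact: cvg_id|exact: cvg_cst]].
    by apply: (cvgr_lt _ c); rewrite mul0r mulr0.
  have fs := @filter_forall _ _ _ ((0 : R)^'+) _ ws.
  near ((0 : R)^'+) => s.
  have s0 : 0 < s by near: s; exact: nbhs_right_gt.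
  have s1 : s <= 1 by near: s; exact: nbhs_right_le.
  have ss i : L * (s * dot w w) < dot w (nu i) by move: i; near: s; exact: fs.
  exists s; split; first by rewrite s0.
  move=> i; have -> : x0 + s *: w - x0 = s *: w by rewrite addrC addKr.
  by rewrite !dotZl dotZr mulrCA ltr_pM2l.
have Oy : O (x0 + s *: w).
  by apply: open_convex_segment => //; case/(boundary_open _ oO): bO.
set y := x0 + s *: w in Gs Oy.
apply: contrapT => nOx.
have [t /andP[t0 t1] bz] := segment_meets_boundary oO Oy nOx.
set z := y + t *: (x - y) in bz.
have Gz : G z.
  move=> i; have zE : z - x0 = (1 - t) *: (y - x0) + t *: (x - x0).
    by apply/rowP => j; rewrite !mxE; ring.
  rewrite zE; move: (Gs i) (Gx i); move: (y - x0) (x - x0) => a c ya xc.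
  (* Convexity of the squared norm: the gap is t (1 - t) |a - c|^2. *)
  have ac : 0 <= L * (t * (1 - t) * dot (a - c) (a - c)).
    apply: mulr_ge0; first exact: ltW.
    by apply: mulr_ge0; rewrite ?dot_ge0 // mulr_ge0 ?subr_ge0.
  rewrite !dotE in ac *; rewrite (dotC c a) in ac *.
  have [t10|t10] := eqVneq t 0.
    by rewrite t10; move: ya xc; lra.
  have {t10}t0 : 0 < t by rewrite lt_def t10 t0.
  have h1 : (1 - t) * (L * dot a a) <= (1 - t) * dot a (nu i).
    by rewrite ler_wpM2l ?subr_ge0 // ltW.
  have h2 : t * (L * dot c c) < t * dot c (nu i) by rewrite ltr_pM2l.
  move: h1 h2 ac; clear; lra.
have : (\bigcup_i S i) z.
  by rewrite -bS; split => //; rewrite /eball /=; exact: lt_le_trans (GL _ Gz) Lrad.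
by move=> [i _ Sz]; have := tang i z Sz (GL _ Gz); rewrite leNgt Gz.
Unshelve. all: by end_near. Qed.

Section Cone.
Variables (k : nat) (x0 : 'rV[R]_n) (nu : 'I_k -> 'rV[R]_n).
Let V := open_cone x0 nu.

Lemma open_cone_dil l z : 0 < l -> V z -> V (dil x0 l z).
Proof. by move=> l0 Vz i; rewrite dil_sub dotZl mulr_gt0 // Vz. Qed.

Lemma boundary_cone_dil l z : 0 < l -> boundary V z -> boundary V (dil x0 l z).
Proof.
have oV : open V := @open_open_cone _ _ _ _ _.
move=> l0 /(boundary_open _ oV)[cz nz]; apply/boundary_open => //; split.
  move=> B nB; have nB' : nbhs z (dil x0 l @^-1` B) by exact: dil_continuous nB.
  have [y [Vy By]] := cz _ nB'; exists (dil x0 l y); split=> //.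
  exact: open_cone_dil.
move=> Vz; apply: nz; rewrite -(dilK x0 (lt0r_neq0 l0) z).
by apply: open_cone_dil; rewrite ?invr_gt0.
Qed.

End Cone.

End Geometry.

(** * Quantitative estimate in the cone and conclusion *)

Section Final.
Context {R : realType} {n : nat}.

Lemma cvg_dot_coord {T : Type} (F : set_system T) {FF : Filter F}
    (u : T -> 'rV[R]_n) (a v : 'rV[R]_n) :
  (forall i, (fun t => u t 0 i) @ F --> a 0 i) ->
  (fun t => dot (u t) v) @ F --> dot a v.
Proof.
move=> ua; rewrite /dot; apply: cvg_big => [|i _]; first exact: add_continuous.
by apply: cvgM; [exact: ua|exact: cvg_cst].
Qed.

Section ConeEstimate.
Variables (k : nat) (x0 b : 'rV[R]_n) (nu : 'I_k -> 'rV[R]_n) (delta : R).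
Variable g : 'rV[R]_n -> R.
Let V := open_cone x0 nu.
Hypothesis nu1 : forall i, enorm (nu i) = 1.
Hypothesis delta0 : 0 < delta.
Hypothesis solg : the_dirichlet_solution V g.

Let K := [set y : 'rV[R]_n | `|y - x0| <= 2] `&`
  \bigcap_i [set y : 'rV[R]_n | delta / 2 <= dot (y - x0) (nu i)].

Let KV : K `<=` V.
Proof.
by move=> y [_ Ky] i; apply: lt_le_trans (Ky i I); rewrite divr_gt0.
Qed.

Let compactK : compact K.
Proof.
have cs (x : 'rV[R]_n) : (fun y => y - x0) @ x --> x - x0.
  exact: (cvgB cvg_id (cvg_cst x0)).
apply: (@subclosed_compact _ _ [set y : 'rV[R]_n | `|y| <= 2 + `|x0|]).
- apply: closedI.
    apply: (@preimage_closed _ _ (fun y : 'rV[R]_n => `|y - x0|)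
      [set r : R | r <= 2]).
      by move=> y _; exact: (cvg_norm (cs y)).
    exact: closed_le.
  apply: closed_bigI => i _.
  apply: (@preimage_closed _ _ (fun y : 'rV[R]_n => dot (y - x0) (nu i))
    [set r : R | delta / 2 <= r]); last exact: closed_ge.
  by move=> y _; exact: (cvg_dot (cs y) (cvg_cst (nu i))).
- exact: compact_norm_ball.
move=> y [/= y2 _]; rewrite -[y](subrK x0).
by apply: le_trans (ler_normD _ _) _; rewrite lerD2r.
Qed.

Let bounds : K !=set0 -> exists m M Lam : R,
  [/\ 0 < m, 0 <= Lam &
      forall y, K y -> [/\ m <= g y, g y <= M & dot (grad g y) b <= Lam]].
Proof.
move=> K0; have [[_ smg _ posg _] _] := solg.
have cg : {within K, continuous g}.
  apply: continuous_in_subspaceT => y; rewrite inE => /KV Vy.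
  exact: differentiable_continuous (smooth_differentiable smg Vy).
have cdg : {within K, continuous (fun y => dot (grad g y) b)}.
  apply: continuous_in_subspaceT => y; rewrite inE => /KV Vy.
  apply: (@cvg_dot_coord _ (nbhs y)) => i.
  rewrite (_ : (fun z => grad g z 0 i) = partial i g); last first.
    by apply/funext => z; rewrite mxE.
  by rewrite mxE; exact: (differentiable_continuous (smooth_partial i smg Vy)).
have [ym + Hm] := compact_EVT_min K0 compactK cg.
have [yM _ HM] := compact_EVT_max K0 compactK cg.
have [yL _ HL] := compact_EVT_max K0 compactK cdg.
rewrite inE => /KV Vym.
exists (g ym), (g yM), (`|dot (grad g yL) b|); split => //; first exact: posg.
move=> y /mem_set Ky; split; [exact: Hm|exact: HM|].
exact: le_trans (HL _ Ky) (ler_norm _).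
Qed.

(** By homogeneity g (mob x q) = e g (th - s1 b), where e = |x - x0|, th is the
unit direction of x - x0 and s1 = (e^2 + q^2) / e = O(e). For small e the
segment from th to th - s1 b stays in a fixed compact subset K of V, on which
g >= m > 0 and <grad g, b> <= Lam; so the value drops by at most
Lam s1 <= C e g (th). *)
Lemma cone_estimate : exists C : R, 0 <= C /\ exists2 r : R, 0 < r &
  forall x q, 0 < enorm (x - x0) < r ->
    (forall i, delta * enorm (x - x0) <= dot (x - x0) (nu i)) ->
    0 <= q <= g x ->
    V (mob x0 b x q) /\
    (1 - C * enorm (x - x0)) * g x <= g (mob x0 b x q).
Proof.
have oV : open V := @open_open_cone _ _ _ _ _.
have dirK x : 0 < enorm (x - x0) ->
    (forall i, delta * enorm (x - x0) <= dot (x - x0) (nu i)) ->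
    let th := dil x0 (enorm (x - x0))^-1 x in
    [/\ enorm (th - x0) = 1, forall i, delta <= dot (th - x0) (nu i) & K th].
  move=> e0 cx th; have en : enorm (th - x0) = 1.
    by rewrite dil_sub enormZ gtr0_norm ?invr_gt0 // mulVf // gt_eqF.
  have dn i : delta <= dot (th - x0) (nu i).
    by rewrite dil_sub dotZl mulrC ler_pdivlMr.
  split => //; split => [|i _] /=.
    by apply: le_trans (norm_le_enorm _) _; rewrite en; lra.
  by apply: le_trans (dn i); have := delta0; lra.
have [K0|nK] := pselect (K !=set0); last first.
  exists 0; split=> //; exists 1 => // x q /andP[e0 _] cx _; case: nK.
  by have [_ _ Kth] := dirK _ e0 cx; eexists; exact: Kth.
have [m [M [Lam [m0 Lam0 bd]]]] := bounds K0.
have [[_ smg _ posg _] _] := solg.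
pose N := 1 + M ^+ 2; have N0 : 0 < N by rewrite ltr_pwDl // sqr_ge0.
pose C := Lam * N / m.
have C0 : 0 <= C by rewrite /C divr_ge0 ?mulr_ge0 // ltW.
(* e * D <= 1 forces s1 * |b| <= min (1, delta / 2), so that th - s1 b stays
   in K. *)
pose D := N * enorm b * (1 + 2 / delta) + 1.
have D0 : 0 < D.
  rewrite /D ltr_wpDl // !mulr_ge0 ?enorm_ge0 //; first exact: ltW.
  by rewrite addr_ge0 // divr_ge0 // ltW.
exists C; split=> //; exists D^-1; first by rewrite invr_gt0.
move=> x q /andP[e0 er] cx /andP[q0 qg].
set e := enorm (x - x0) in e0 er cx *.
have [en dn Kth] := dirK _ e0 cx; rewrite -/e in en dn Kth.
set th := dil x0 e^-1 x in en dn Kth.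
have xE : x = dil x0 e th.
  by have := @dilK R n x0 e^-1; rewrite invrK => ->; rewrite ?invr_eq0 ?gt_eqF.
have gx : g x = e * g th.
  rewrite {1}xE; apply: (homogeneous oV _ _ solg) => //; last exact: KV.
  - by move=> *; exact: open_cone_dil.
  - by move=> *; exact: boundary_cone_dil.
have [gm gM _] := bd _ Kth.
pose s1 := (e ^+ 2 + q ^+ 2) / e.
have s10 : 0 < s1 by rewrite divr_gt0 // ltr_pwDl ?exprn_gt0 // sqr_ge0.
have s1N : s1 <= e * N.
  rewrite /s1 ler_pdivrMr // /N.
  have : q ^+ 2 <= (e * M) ^+ 2.
    rewrite ler_pXn2r ?nnegrE //.
      by apply: le_trans qg _; rewrite gx ler_pM2l.
    by rewrite mulr_ge0 // ?(ltW e0) // (le_trans _ gM) // (le_trans _ gm) // ltW.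
  by rewrite exprMn; lra.
have eD : e * D <= 1 by rewrite -ler_pdivlMr // mul1r ltW.
have s1b : s1 * enorm b <= 1 /\ s1 * enorm b <= delta / 2.
  have h1 : s1 * enorm b <= e * (N * enorm b).
    by rewrite mulrA ler_wpM2r ?enorm_ge0.
  have h2 : 0 <= e * (N * enorm b) by rewrite !mulr_ge0 ?enorm_ge0 // ltW.
  have h3 : e * (N * enorm b) * (1 + 2 / delta) <= 1.
    by apply: le_trans eD; rewrite -mulrA ler_pM2l // /D -mulrA lerDl.
  split.
    apply: le_trans h1 _; apply: le_trans h3; rewrite ler_peMr // lerDl.
    by rewrite divr_ge0 // ltW.
  apply: le_trans h1 _; set a := e * (N * enorm b) in h2 h3 *.
  have h4 : a * (2 / delta) <= 1 by apply: le_trans h3; rewrite mulrDr mulr1 lerDr.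
  by move: h4; rewrite mulrA ler_pdivrMr // mul1r; lra.
pose l s := th + (- s) *: b.
have lK s : 0 <= s <= s1 -> K (l s).
  move=> /andP[ss0 ss1].
  have sb : s * enorm b <= s1 * enorm b by rewrite ler_wpM2r ?enorm_ge0.
  have [b1 b2] := s1b.
  have lE : l s - x0 = (th - x0) - s *: b by rewrite /l scaleNr addrAC.
  split => [|i _] /=; rewrite lE.
    apply: le_trans (ler_normB _ _) _; rewrite normrZ ger0_norm //.
    have h1 := norm_le_enorm (th - x0); rewrite en in h1.
    have h2 : s * `|b| <= s * enorm b by rewrite ler_wpM2l // norm_le_enorm.
    by move: h1 h2 sb b1; lra.
  rewrite dotBl dotZl.
  have h1 := dn i; have h2 : s * dot b (nu i) <= s * enorm b.
    by rewrite ler_wpM2l // dot_unit_le.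
  by move: h1 h2 sb b2; lra.
have mobE : mob x0 b x q = dil x0 e (l s1).
  rewrite /mob -enorm_sqr -/e /dil /l /s1 {1}xE /dil.
  apply/rowP => i; rewrite !mxE; field; by rewrite gt_eqF.
have Kl1 : K (l s1) by apply: lK; rewrite lexx ltW.
rewrite mobE; split; first exact/open_cone_dil/KV.
rewrite (homogeneous oV _ _ solg) //; [|by move=> *; exact: open_cone_dil
  |by move=> *; exact: boundary_cone_dil|exact: KV].
have dl (s : R) : 0 <= s <= s1 ->
    is_derive s 1 (fun r => g (l r)) (- dot (grad g (l s)) b).
  move=> /lK/KV Vs; have dline : is_derive s 1 l (- b).
    have := is_derive_line th (- b) s; rewrite /l.
    by under eq_fun do rewrite scalerN -scaleNr.
  have := is_derive_along (smooth_differentiable smg Vs) dline.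
  by rewrite dotNr.
have [s] : exists2 s, s \in `]0, s1[%R &
    g (l s1) - g (l 0) = - dot (grad g (l s)) b * (s1 - 0).
  apply: (@MVT R (fun r => g (l r)) (fun s => - dot (grad g (l s)) b)) => //.
    by move=> s; rewrite in_itv /= => /andP[? ?]; apply: dl; rewrite !ltW.
  apply: derivable_within_continuous => s; rewrite in_itv /= => s01.
  by case: (dl _ s01).
rewrite in_itv /= => /andP[ss0 ss1].
have -> : l 0 = th by rewrite /l oppr0 scale0r addr0.
have Ks : K (l s) by apply: lK; rewrite !ltW.
have [_ _ gL] := bd _ Ks; rewrite subr0 => gl.
have h1 : g th - Lam * s1 <= g (l s1).
  have h : dot (grad g (l s)) b * s1 <= Lam * s1 by rewrite ler_pM2r.
  by move: gl h; rewrite mulNr; lra.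
rewrite gx mulrCA ler_pM2l //; apply: le_trans h1.
rewrite mulrBl mul1r lerD2l lerN2.
apply: (@le_trans _ _ (Lam * (e * N))); first by rewrite ler_wpM2l.
have -> : Lam * (e * N) = C * e * m by rewrite /C; field; rewrite gt_eqF.
by rewrite ler_wpM2l // mulr_ge0 // ltW.
Qed.

End ConeEstimate.

Lemma common_tangency (k : nat) (S : 'I_k -> set 'rV[R]_n) (x0 : 'rV[R]_n)
    (nu : 'I_k -> 'rV[R]_n) (rad : R) :
  0 < rad -> (forall i, S i x0) -> (forall i, unit_normal (S i) x0 (nu i)) ->
  exists L : R, [/\ 0 < L, L^-1 <= rad &
    forall i x, S i x -> enorm (x - x0) < L^-1 ->
      dot (x - x0) (nu i) <= L * dot (x - x0) (x - x0)].
Proof.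
move=> rad0 Sx0 nuS.
have /choice[Li HLi] : forall i, exists L : R, 0 < L /\ forall x, S i x ->
    enorm (x - x0) < L^-1 -> dot (x - x0) (nu i) <= L * dot (x - x0) (x - x0).
  by move=> i; have [L L0 HL] := C11_tangent (Sx0 i) (nuS i); exists L.
pose L := \sum_i Li i + rad^-1.
have LiL i : Li i <= L.
  rewrite /L (bigD1 i) //= -addrA lerDl addr_ge0 ?invr_ge0 ?(ltW rad0) //.
  by apply: sumr_ge0 => j _; case: (HLi j) => /ltW.
have radL : rad^-1 <= L.
  by rewrite /L lerDr sumr_ge0 // => j _; case: (HLi j) => /ltW.
have L0 : 0 < L by apply: lt_le_trans radL; rewrite invr_gt0.
exists L; split=> //.
  by rewrite -[leRHS]invrK lef_pV2 // posrE invr_gt0.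
move=> i x Sx xL; have [Li0 Hi] := HLi i.
apply: le_trans (Hi _ Sx _) _; last by rewrite ler_wpM2r ?dot_ge0.
by apply: lt_le_trans xL _; rewrite lef_pV2.
Qed.

Lemma steep_direction (k : nat) (x0 : 'rV[R]_n) (nu : 'I_k -> 'rV[R]_n) (L : R) :
  0 < L -> open_cone x0 nu !=set0 ->
  exists b : 'rV[R]_n, forall i, L <= dot b (nu i).
Proof.
move=> L0 [p Vp]; pose T := \sum_i L / dot (p - x0) (nu i).
exists (T *: (p - x0)) => i; rewrite dotZl -ler_pdivrMr ?Vp //.
rewrite /T (bigD1 i) //= lerDl sumr_ge0 // => j _.
by rewrite divr_ge0 ?ltW // Vp.
Qed.

End Final.

Theorem theorem1p1 (R : realType) (n k : nat)
    (x0 : 'rV[R]_n) (rad : R) (S : 'I_k -> set 'rV[R]_n)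
    (nu : 'I_k -> 'rV[R]_n) (delta : R) :
  0 < rad ->
  (forall i, C11_hypersurface (S i)) ->
  (forall i, S i x0) ->
  (forall i, unit_normal (S i) x0 (nu i)) ->
  (forall i j, i != j -> dihedral_angle (nu i) (nu j) < pi) ->
  0 < delta ->
  exists C : R,
    forall (Omega : set 'rV[R]_n) (f fV : 'rV[R]_n -> R),
      bounded_convex_domain Omega ->
      boundary Omega x0 ->
      boundary Omega `&` eball x0 rad = \bigcup_i S i ->
      (forall i x, Omega x -> 0 < dot (x - x0) (nu i)) ->
      dirichlet_solution Omega f ->
      the_dirichlet_solution (open_cone x0 nu) fV ->
      exists2 r : R, 0 < r &
        forall x, Omega x -> enorm (x - x0) < r ->
          delta * enorm (x - x0) <= dist_set x (boundary Omega) ->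
          `|f x - fV x| <= C * f x * enorm (x - x0).
Proof.
move=> rad0 _ Sx0 nuS _ delta0.
have nu1 i : enorm (nu i) = 1 by case: (nuS i).
have [L [L0 Lrad tang]] := common_tangency rad0 Sx0 nuS.
have [[g solg]|nog] :=
  pselect (exists g, the_dirichlet_solution (open_cone x0 nu) g); last first.
  by exists 0 => Omega f fV _ _ _ _ _ sV; case: nog; exists fV.
have [Vn0|V0] := pselect (open_cone x0 nu !=set0); last first.
  exists 0 => Omega f fV [_ [p Op] _ _] _ _ OV _ _; case: V0.
  by exists p => i; exact: OV.
have [b bL] := steep_direction L0 Vn0.
have [C [C0 [r0 r00 est]]] := cone_estimate b nu1 delta0 solg.
exists (2 * C) => Omega f fV domO bO bS OV solf solV.
have [oO _ cO bdO] := domO.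
have [i0] : exists i : 'I_k, True.
  have : (\bigcup_i S i) x0.
    rewrite -bS; split=> //; rewrite /eball /=.
    by rewrite subrr -(scale0r 0) enormZ normr0 mul0r.
  by move=> [i _ _]; exists i.
move=> _.
have n0 : (0 < n)%N.
  rewrite lt0n; apply/eqP => nE; have := nu1 i0; rewrite /enorm /dot.
  rewrite big1 ?sqrtr0 => [/eqP|i]; first by rewrite eq_sym oner_eq0.
  by have := ltn_ord i; rewrite {2}nE.
have oV : open (open_cone x0 nu) := @open_open_cone _ _ _ _ _.
have OsubV : Omega `<=` open_cone x0 nu by move=> y Oy i; exact: OV.
have [sg ug] := solg; have [_ uV] := solV.
have fVE x : Omega x -> fV x = g x.
  by move=> /OsubV Vx; apply/esym/uV => //; exact: subset_closure.
have fg : forall x, Omega x -> f x <= g x.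
  exact: comparison n0 oO oV bdO OsubV solf sg.
have mobP x q : open_cone x0 nu (mob x0 b x q) ->
    [/\ enorm (x - x0) < L^-1, Omega x & q ^+ 2 * L < L^-1].
  move=> Vx.
  have key i : (dot (x - x0) (x - x0) + q ^+ 2) * L < dot (x - x0) (nu i).
    have rho0 : 0 <= dot (x - x0) (x - x0) + q ^+ 2.
      by rewrite addr_ge0 ?dot_ge0 ?sqr_ge0.
    have := Vx i; rewrite /mob; move: (dot _ _ + _) rho0 => rho rho0.
    rewrite [_ - _ - x0]addrAC (dotBl (x - x0)) dotZl subr_gt0; apply: le_lt_trans.
    by rewrite ler_wpM2l.
  have q2 : 0 <= q ^+ 2 * L by rewrite mulr_ge0 ?sqr_ge0 // ltW.
  have d2 : 0 <= dot (x - x0) (x - x0) * L by rewrite mulr_ge0 ?dot_ge0 // ltW.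
  have [|xL Ox] := cusp_inside i0 domO bO bS OV nu1 L0 Lrad tang (x := x).
    by move=> i; apply: le_lt_trans (key i); rewrite mulrDl mulrC lerDl.
  split=> //; apply: lt_trans xL; apply: lt_le_trans (dot_unit_le _ (nu1 i0)).
  by apply: le_lt_trans (key i0); rewrite mulrDl lerDr.
have mobK x q : open_cone x0 nu (mob x0 b x q) ->
    `|x| <= `|x0| + L^-1 + 1 /\ q < `|x0| + L^-1 + 1.
  move=> /mobP[xL _ qL]; split.
    rewrite -[x](subrK x0); apply: le_trans (ler_normD _ _) _.
    have := norm_le_enorm (x - x0); lra.
  apply: (@lt_le_trans _ _ (L^-1 + 1)); last first.
    by rewrite -addrA lerDr.
  have Li0 : 0 < L^-1 by rewrite invr_gt0.
  rewrite ltNge; apply/negP => Lq.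
  have {}Lq : L^-1 <= q by apply: le_trans Lq; rewrite lerDl.
  have : L^-1 ^+ 2 <= q ^+ 2.
    by rewrite ler_pXn2r // nnegrE ltW // (lt_le_trans Li0).
  rewrite -(ler_pM2r L0) expr2 -mulrA mulVf ?gt_eqF // mulr1.
  by rewrite leNgt qL.
have barrier := mobius_barrier n0 oV oO
  (@open_cone_dil _ _ _ x0 nu) (@boundary_cone_dil _ _ _ x0 nu) solf solg
  (fun x q Vx => let: And3 _ Ox _ := mobP x q Vx in Ox) mobK.
have [_ _ _ posf _] := solf; have [_ _ _ posg _] := sg.
have D0 : 0 < 2 * C + 1 by rewrite ltr_wpDl // mulr_ge0.
(* The second bound gives C |x - x0| <= 1 / 2, hence fV <= 2 f. *)
exists (Num.min r0 (2 * C + 1)^-1); first by rewrite lt_min r00 invr_gt0.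
move=> x Ox; rewrite lt_min => /andP[xr xC] xd.
have e0 : 0 < enorm (x - x0).
  rewrite enorm_gt0 subr_eq0; apply/eqP => xx0.
  by move/(boundary_open _ oO): bO => [_]; rewrite -xx0.
have cx i : delta * enorm (x - x0) <= dot (x - x0) (nu i).
  by apply: dist_boundary_le xd => //; exact: OV.
rewrite fVE // distrC ger0_norm ?subr_ge0 ?fg //.
set e := enorm (x - x0) in xr xC e0 cx xd *.
have gx0 : 0 < g x by apply: posg; exact: OsubV.
have Ce : C * e <= 2^-1.
  have : e * (2 * C + 1) < 1 by rewrite -ltr_pdivlMr // mul1r.
  by rewrite mulrDr mulr1 mulrCA (mulrC e); lra.
have Ce0 : 0 <= C * e by rewrite mulr_ge0 // ltW.
pose q := (1 - C * e) * g x.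
have q01 : 0 <= q <= g x.
  rewrite mulr_ge0 ?(ltW gx0) //; last by lra.
  by rewrite /= ler_piMl ?(ltW gx0) //; lra.
have [Vq gq] := est x q (introT andP (conj e0 xr)) cx q01.
have qf : (1 - C * e) * g x <= f x := barrier x q Vq gq.
have gf : g x <= 2 * f x.
  have : 2^-1 * g x <= (1 - C * e) * g x by rewrite ler_pM2r //; lra.
  by lra.
have -> : 2 * C * f x * e = (C * e) * (2 * f x) by ring.
apply: (@le_trans _ _ (C * e * g x)); first by lra.
by rewrite ler_wpM2l.
Qed.
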